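(* For the ferromagnetic Ising and Potts models on a graph $G=(V,E)$ with $n=|V|\ge2$ vertices and maximum degree $\Delta\ge1$: if the system is $\eta$-spectrally independent and $b$-marginally bounded, then there exists a constant $C=C(b,\eta,\Delta)$ such that the mixing time of the Swendsen-Wang dynamics is at most $C\log n$ and its modified log-Sobolev constant is at least $C^{-1}$. The constant $C$ satisfies $C=\left(\frac2b\right)^{O\left(\Delta(1+\frac{\eta}{b})\right)}$, the implied constant in $O(\cdot)$ being absolute.
   Context: For an integer $q\ge2$ and $\beta>0$, the ferromagnetic Potts model (Ising when $q=2$) on $G=(V,E)$ is the distribution $\mu(\sigma)\propto\exp(\beta M(\sigma))$ on $\Omega=[q]^V$, $[q]=\{1,\dots,q\}$, where $M(\sigma)$ is the number of edges monochromatic in $\sigma$. Swendsen-Wang dynamics: from $\sigma_t\in[q]^V$, let $M_t$ be the set of monochromatic edges in $\sigma_t$; keep each edge of $M_t$ independently with probability $p=1-e^{-\beta}$ to obtain $A_t\subset M_t$; then, independently for each connected component of $(V,A_t)$ (including isolated vertices), choose a spin uniformly from $[q]$ and assign it to all vertices of the component; the result is $\sigma_{t+1}$. A pinning is an assignment $\tau\in[q]^U$ for some $U\subset V$; $\mu^\tau=\mu(\cdot\mid\sigma_U=\tau)$. The influence matrix $J^\tau$ is indexed by pairs $(x,a)$, $x\in V\setminus U$, $a\in[q]$, with $J^\tau(x,a;x,a')=0$ and $J^\tau(x,a;y,a')=\mu^\tau(\sigma_y=a'\mid\sigma_x=a)-\mu^\tau(\sigma_y=a')$ for $x\ne y$;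 its eigenvalues are real. The system is $\eta$-spectrally independent if the largest eigenvalue satisfies $\lambda_1(J^\tau)\le\eta$ for all pinnings $\tau$. It is $b$-marginally bounded ($b>0$) if $\mu^\tau(\sigma_x=a)\ge b$ for all pinnings $\tau$ on $U$, all $x\in V\setminus U$ and all $a\in[q]$. Mixing time: $T_{\rm mix}(P)=\max_{X_0\in\Omega}\min\{t\ge0:\|P^t(X_0,\cdot)-\mu\|_{TV}\le 1/4\}$. For $f\ge0$, $\mathrm{Ent}(f)=\mu[f\log(f/\mu[f])]$; the modified log-Sobolev constant is the largest $\rho$ with $\mu[f(1-P)\log f]\ge\rho\,\mathrm{Ent}(f)$ for all $f\ge0$ (usual limiting conventions where $f$ vanishes). *)

(* Defs.v *)
From HB Require Import structures.
From mathcomp Require Import all_boot all_order all_algebra.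
From mathcomp Require Import all_classical all_reals all_analysis.

Set Implicit Arguments.
Unset Strict Implicit.
Unset Printing Implicit Defensive.

Import Order.TTheory GRing.Theory Num.Theory.

Local Open Scope ring_scope.

Section Graph.
Variable V : finType.
Implicit Type E A : {set {set V}}.

Definition simple_graph E : Prop := forall e : {set V}, e \in E -> #|e| = 2.

Definition max_degree E : nat := (\max_(x : V) #|[set e in E | x \in e]|)%N.

Definition adj A : rel V := fun x y => [set x; y]%SET \in A.

End Graph.

Section Probability.
Variables (R : realType) (T : finType).
Implicit Types (mu nu f : T -> R) (P : T -> T -> R) (A B : pred T).

Definition prob mu A : R := \sum_(s | A s) mu s.

Definition cond_prob mu A B : R := prob mu [predI A & B] / prob mu B.

Definition expect mu f : R := \sum_s mu s * f s.

Definition tv_dist mu nu : R := 2^-1 * \sum_s `|mu s - nu s|.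

Fixpoint kernel_iter P (t : nat) (x y : T) : R :=
  if t is t'.+1 then \sum_z P x z * kernel_iter P t' z y else (x == y)%:R.

(* Equal to +oo when the chain never gets within 1/4 of mu. *)
Definition mixing_time_from P mu (x : T) : \bar R :=
  ereal_inf [set t%:R%:E | t in
    [set t : nat | tv_dist (kernel_iter P t x) mu <= 4^-1]]%classic.

Definition mixing_time P mu : \bar R :=
  ereal_sup [set mixing_time_from P mu x | x in [set: T]]%classic.

(* Since ln 0 = 0 in the library, 0 log 0 = 0. *)
Definition entropy mu f : R :=
  \sum_s mu s * (f s * ln (f s / expect mu f)).

(* mu[f (1 - P) log f], computed with log 0 = -oo and 0 * oo = 0.  The value
   is +oo as soon as P allows a transition (of positive mass) from a point
   where f > 0 to a point where f = 0; no summand is -oo when f, mu, P are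
   nonnegative. *)
Definition dirichlet_log P mu f : \bar R :=
  (\sum_(x : T) (mu x * f x)%:E *
     (lne (f x)%:E - \sum_(y : T) (P x y)%:E * lne (f y)%:E))%E.

Definition mls_inequality P mu (rho : R) : Prop :=
  forall f, (forall x, 0 <= f x) ->
    ((rho * entropy mu f)%:E <= dirichlet_log P mu f)%E.

Definition mls_constant P mu : \bar R :=
  ereal_sup [set rho%:E | rho in mls_inequality P mu]%classic.

End Probability.

Section Potts.
Variables (R : realType) (V : finType) (E : {set {set V}}) (q : nat) (beta : R).

Definition config : finType := {ffun V -> 'I_q}.
Implicit Type sigma : config.

Definition mono_edges sigma : {set {set V}} :=
  [set e in E | [forall x in e, forall y in e, sigma x == sigma y]]%SET.

Definition weight sigma : R := expR (beta * #|mono_edges sigma|%:R).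

Definition gibbs sigma : R := weight sigma / \sum_(s : config) weight s.

(* Probability that keeping each edge of M independently with probability
   p = 1 - exp(-beta) leaves exactly A. *)
Definition percolation (M A : {set {set V}}) : R :=
  if A \subset M then
    (1 - expR (- beta)) ^+ #|A| * expR (- beta) ^+ #|M :\: A|%SET
  else 0.

(* Independent uniform spins on the connected components of (V, A): each
   colouring that is constant on components has probability q^-(number of
   components). *)
Definition component_colouring (A : {set {set V}}) sigma : R :=
  if [forall x, forall y, connect (adj A) x y ==> (sigma x == sigma y)] then
    q%:R ^- n_comp (adj A) V
  else 0.

Definition swendsen_wang (sigma sigma' : config) : R :=
  \sum_(A : {set {set V}})
     percolation (mono_edges sigma) A * component_colouring A sigma'.

(* A pinning on U is encoded by tau with U = {x | tau x <> None}. *)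
Definition pinning : finType := {ffun V -> option 'I_q}.
Implicit Type tau : pinning.

Definition agrees tau : pred config :=
  fun sigma => [forall x, if tau x is Some a then sigma x == a else true].

Definition gibbs_pinned tau sigma : R :=
  cond_prob gibbs (pred1 sigma) (agrees tau).

Definition spin_at (x : V) (a : 'I_q) : pred config := fun sigma => sigma x == a.

Definition free_vertex tau : finType := {x : V | tau x == None}.

Definition influence tau (i j : free_vertex tau * 'I_q) : R :=
  let: (x, a) := i in let: (y, a') := j in
  if x == y then 0
  else cond_prob (gibbs_pinned tau) (spin_at (val y) a') (spin_at (val x) a)
       - prob (gibbs_pinned tau) (spin_at (val y) a').

Definition influence_mx tau : 'M[R]_(#|{: free_vertex tau * 'I_q}|) :=
  \matrix_(i, j) influence (enum_val i) (enum_val j).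

(* The eigenvalues of the influence matrix are all real; the value is -oo for
   the empty matrix, that is, when every vertex is pinned. *)
Definition lambda1 tau : \bar R :=
  ereal_sup [set l%:E | l in
    [set l : R | eigenvalue (influence_mx tau) l]]%classic.

Definition spectrally_independent (eta : R) : Prop :=
  forall tau, (lambda1 tau <= eta%:E)%E.

Definition marginally_bounded (b : R) : Prop :=
  0 < b /\
  forall tau (x : V) (a : 'I_q), tau x = None ->
    b <= prob (gibbs_pinned tau) (spin_at x a).

End Potts.

(* Main.v *)
(* Fix f > 0.  Let h(D) be the entropy of f lost by averaging over the spins in D,
   and k(D) the entropy lost when, in the Edwards-Sokal coupling, only the vertices
   of D that are isolated in the percolated edge set are resampled.  Then h(V) is
   the entropy of f, k is submodular, and k(V) is at most the entropy lost in one
   Swendsen-Wang step.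

   Spectral independence and marginal bounds control the second differences of h:
   the average of h over sets of size m grows at most like m^a with a = O(1 + eta/b),
   so that theta^a h(V) <= E h(B) when B contains each vertex with probability theta.
   When U and Z are not adjacent, the set U is isolated with probability at least
   e^(- beta Delta |U|) >= b^|U|, whence h(U u Z) - h(Z) <= b^-|U| (k(U u Z) - k(Z)).
   Revealing B vertex by vertex and applying this to the cluster U of the new vertex,
   the factor b^-|U| is beaten by the probability of a large cluster as soon as
   theta is about b 2^-Delta, and submodularity of k gives E h(B) <= K E k(B).
   Hence one step contracts entropy by a constant factor, which yields both the
   modified log-Sobolev inequality and the mixing time. *)

Require Import Defs.
From HB Require Import structures.
From mathcomp Require Import all_boot all_order all_algebra.
From mathcomp Require Import all_classical all_reals all_analysis.
From mathcomp Require Import finset complex spectral ring lra zify.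

Set Implicit Arguments.
Unset Strict Implicit.
Unset Printing Implicit Defensive.

Import Order.TTheory GRing.Theory Num.Theory.

Local Open Scope ring_scope.

(** * Relative entropy integrand *)

Section Bregman.
Variable R : realType.
Implicit Types u t : R.

(** The obstacle is that h, taken with the interacting measure, is not submodular in general,
    whereas k is, because isolated spins are independent and uniform given the edge set. So h must
    be traded for k before a gain is split over vertices, one whole cluster at a time. The cluster U
    must have no neighbour in Z: the reweighting that turns the law conditioned on U being isolated
    back into mu is then constant in the spins of Z. Entropy differences are written as weighted
    sums of u ln(u/t) - u + t, which is nonnegative, jointly convex and homogeneous, so no
    conditional measure has to be normalised. The constant has two sources. The bound e^(beta deg x)
    <= 1/b, read off from recolouring one vertex of a constant configuration, keeps beta out of it.
    The choice theta = b / 2^(Delta+2) makes theta / (b (1 - theta)) at most 2^-(Delta+1), a weight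
    per vertex at which the connected sets containing a given vertex sum to at most 1. The dominant
    factor theta^-a, with a between 4 eta / b + 1 and 4 eta / b + 2, yields the exponent of order
    Delta (1 + eta / b). *)

Definition bregman u t : R := u * (ln u - ln t) - u + t.

Lemma ln_le_sub1 (z : R) : 0 < z -> ln z <= z - 1.
Proof.
move=> z0; have -> : z = 1 + (z - 1) by ring.
by apply: le_trans (le_ln1Dx _) _; lra.
Qed.

Lemma bregman_ge0 u t : 0 < u -> 0 < t -> 0 <= bregman u t.
Proof.
move=> u0 t0; have h : ln (t / u) <= t / u - 1 by apply: ln_le_sub1; rewrite divr_gt0.
rewrite ln_div ?posrE // in h; rewrite /bregman.
have : u * (ln t - ln u) <= u * (t / u - 1) by rewrite ler_pM2l.
have -> : u * (t / u - 1) = t - u by field; rewrite gt_eqF.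
by lra.
Qed.

(* The right-hand side is the tangent plane at (u0, t0) of [bregman], which is
   homogeneous of degree 1. *)
Lemma bregman_tangent u t u0 t0 : 0 < u -> 0 < t -> 0 < u0 -> 0 < t0 ->
  u * (ln u0 - ln t0) + t * (1 - u0 / t0) <= bregman u t.
Proof.
move=> hu ht hu0 ht0.
have := @bregman_ge0 u (t * (u0 / t0)) hu (mulr_gt0 ht (divr_gt0 hu0 ht0)).
rewrite /bregman lnM ?posrE ?divr_gt0 // ln_div ?posrE //; lra.
Qed.

Lemma wsum_gt0 (I : finType) (P : pred I) (w v : I -> R) :
  (forall i, P i -> 0 <= w i) -> (forall i, P i -> 0 < v i) ->
  0 < \sum_(i | P i) w i -> 0 < \sum_(i | P i) w i * v i.
Proof.
move=> w0 v0 sw; have h i : P i -> 0 <= w i * v i by move=> Pi; rewrite mulr_ge0 ?w0 ?ltW ?v0.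
rewrite lt_def sumr_ge0 // andbT; apply/negP => /eqP e.
move: sw; rewrite big1 ?ltxx // => i Pi.
have /eqP := psumr_eq0P h e Pi.
by rewrite mulf_eq0 (gt_eqF (v0 i Pi)) orbF => /eqP.
Qed.

(** Jensen by the tangent plane at the averaged point. Homogeneity makes that plane linear, so the
    weights need only have a positive sum. *)
Lemma bregman_sum (I : finType) (P : pred I) (w u t : I -> R) :
  (forall i, P i -> 0 <= w i) -> (forall i, P i -> 0 < u i) ->
  (forall i, P i -> 0 < t i) ->
  0 < \sum_(i | P i) w i ->
  bregman (\sum_(i | P i) w i * u i) (\sum_(i | P i) w i * t i)
    <= \sum_(i | P i) w i * bregman (u i) (t i).
Proof.
move=> w0 u0 t0 sw.
set a := (\sum_(i | P i) w i * u i); set b := (\sum_(i | P i) w i * t i).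
have a0 : 0 < a by exact: wsum_gt0.
have b0 : 0 < b by exact: wsum_gt0.
have -> : bregman a b = \sum_(i | P i) w i * (u i * (ln a - ln b) + t i * (1 - a / b)).
  have -> : \sum_(i | P i) w i * (u i * (ln a - ln b) + t i * (1 - a / b))
     = a * (ln a - ln b) + b * (1 - a / b).
    by rewrite !mulr_suml -big_split /=; apply: eq_bigr => i _; ring.
  by rewrite /bregman; field; rewrite gt_eqF.
by apply: ler_sum => i Pi; rewrite ler_wpM2l ?w0 // bregman_tangent ?u0 ?t0.
Qed.

Lemma bregmanM c u t : 0 < c -> 0 < u -> 0 < t ->
  bregman (c * u) (c * t) = c * bregman u t.
Proof. by move=> c0 u0 t0; rewrite /bregman !lnM ?posrE //; ring. Qed.

(** With x and y the square roots, (u - t)^2 = (x + y)^2 (x - y)^2. The last factor is at most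
    [bregman u t], by ln z <= z - 1 at z = y / x rather than t / u, and the other at most 2 (u +
    t). *)
Lemma bregman_quadratic u t : 0 < u -> 0 < t ->
  (u - t) ^+ 2 <= 2 * (u + t) * bregman u t.
Proof.
move=> u0 t0.
set x := Num.sqrt u; set y := Num.sqrt t.
have x0 : 0 < x by rewrite sqrtr_gt0.
have y0 : 0 < y by rewrite sqrtr_gt0.
have ux : u = x ^+ 2 by rewrite sqr_sqrtr ?ltW.
have ty : t = y ^+ 2 by rewrite sqr_sqrtr ?ltW.
have h1 : (x - y) ^+ 2 <= bregman u t.
  rewrite /bregman ux ty !lnXn //.
  have h : ln (y / x) <= y / x - 1 by apply: ln_le_sub1; rewrite divr_gt0.
  rewrite ln_div ?posrE // in h.
  have h2 : x ^+ 2 * (ln y - ln x) <= x ^+ 2 * (y / x - 1) by rewrite ler_pM2l // exprn_gt0.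
  have e : x ^+ 2 * (y / x - 1) = x * y - x ^+ 2 by field; rewrite gt_eqF.
  rewrite e in h2.
  have -> : x ^+ 2 * (ln x *+ 2 - ln y *+ 2) - x ^+ 2 + y ^+ 2
    = (x - y) ^+ 2 + 2 * (x * y - x ^+ 2 - x ^+ 2 * (ln y - ln x)) by ring.
  by rewrite lerDl mulr_ge0 // subr_ge0.
have h2 : (x + y) ^+ 2 <= 2 * (u + t).
  by rewrite ux ty; have := sqr_ge0 (x - y); lra.
have -> : (u - t) ^+ 2 = (x + y) ^+ 2 * (x - y) ^+ 2 by rewrite ux ty; ring.
by apply: ler_pM => //; exact: sqr_ge0.
Qed.

(* AM-GM on [bregman_quadratic]; averaged over a density it replaces Pinsker's
   inequality. *)
Lemma abs_sub1_le_bregman u : 0 < u -> `|u - 1| <= 4 * bregman u 1 + (1 + u) / 8.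
Proof.
move=> u0; have B0 := bregman_ge0 u0 (@ltr01 R).
have hq := bregman_quadratic u0 (@ltr01 R); set B := bregman u 1 in B0 hq *.
have h0 : 0 <= 4 * B + (1 + u) / 8 by lra.
rewrite -(@ler_pXn2r _ 2) ?nnegrE // real_normK ?num_real //; apply: le_trans hq _.
have -> : (4 * B + (1 + u) / 8) ^+ 2 = (4 * B - (1 + u) / 8) ^+ 2 + 2 * (u + 1) * B by field.
by rewrite lerDr sqr_ge0.
Qed.

End Bregman.

(** * Conditional averages *)

Section Patch.
Variables (V : finType) (S : finType).
Implicit Types (D : {set V}) (s r : {ffun V -> S}).

Definition patch D s r : {ffun V -> S} := [ffun x => if x \in D then r x else s x].

Definition off_invariant (X : Type) D (g : {ffun V -> S} -> X) : Prop :=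
  forall s r, g (patch D s r) = g s.

Lemma patch_swapK D s r : patch D (patch D s r) (patch D r s) = s.
Proof. by apply/ffunP => x; rewrite !ffunE; case: (x \in D). Qed.

Lemma patch_patch D D' s r r' :
  patch D' (patch D s r) r' = patch (D :|: D') s (patch D' r r').
Proof. by apply/ffunP => x; rewrite !ffunE inE; case: (x \in D'); case: (x \in D). Qed.

Lemma patch_setT s r : patch setT s r = r.
Proof. by apply/ffunP => x; rewrite ffunE inE. Qed.

Lemma patch_set0 s r : patch set0 s r = s.
Proof. by apply/ffunP => x; rewrite ffunE inE. Qed.

Lemma off_invariant_sub (X : Type) D D' (g : {ffun V -> S} -> X) :
  D \subset D' -> off_invariant D' g -> off_invariant D g.
Proof.
move=> sD h s r; rewrite -(h (patch D s r) s) -[RHS](h s s); congr (g _).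
by apply/ffunP => x; rewrite !ffunE; case: ifPn => // /(contra (fintype.subsetP sD x))/negbTE ->.
Qed.

Variable R : realType.

Lemma sum_patch_swap D (F : {ffun V -> S} -> {ffun V -> S} -> R) :
  \sum_s \sum_r F (patch D s r) (patch D r s) = \sum_s \sum_r F s r.
Proof.
rewrite [LHS]pair_bigA [RHS]pair_bigA /=.
rewrite [RHS](reindex_inj (h := fun p => (patch D p.1 p.2, patch D p.2 p.1))) //=.
by apply: (can_inj (g := fun p => (patch D p.1 p.2, patch D p.2 p.1))) => -[s r] /=; rewrite !patch_swapK.
Qed.

(* Resampling on D sums over all r rather than over the restrictions of r to D:
   the extra factor cancels in [cavg], and exchanging s and r on D becomes an
   involution of the pairs (s, r), from which adjointness and the tower property
   follow. *)
Definition resum D (F : {ffun V -> S} -> R) s : R := \sum_r F (patch D s r).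

Lemma resum_invariant D F : off_invariant D (resum D F).
Proof.
move=> s r; apply: eq_bigr => r' _; congr (F _).
by apply/ffunP => x; rewrite !ffunE; case: (x \in D).
Qed.

Lemma resum_resum D D' F s :
  resum D (resum D' F) s = #|{: {ffun V -> S}}|%:R * resum (D :|: D') F s.
Proof.
rewrite /resum.
transitivity (\sum_(r : {ffun V -> S}) \sum_r' F (patch (D :|: D') s (patch D' r r'))).
  by apply: eq_bigr => r _; apply: eq_bigr => r' _; rewrite patch_patch.
rewrite (sum_patch_swap D' (fun r _ => F (patch (D :|: D') s r))).
by rewrite exchange_big /= sumr_const -[LHS]mulr_natl; congr (_%:R * _).
Qed.

Lemma resum_invM D (g F : {ffun V -> S} -> R) s : off_invariant D g ->
  resum D (fun r => g r * F r) s = g s * resum D F s.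
Proof. by move=> h; rewrite /resum mulr_sumr; apply: eq_bigr => r _; rewrite h. Qed.

Definition cavg (w : {ffun V -> S} -> R) D (f : {ffun V -> S} -> R) s : R :=
  resum D (fun r => w r * f r) s / resum D w s.

Lemma cavg_invariant w D f : off_invariant D (cavg w D f).
Proof. by move=> s r; rewrite /cavg !resum_invariant. Qed.

Lemma resum_set0 F s : resum set0 F s = #|{: {ffun V -> S}}|%:R * F s.
Proof.
rewrite /resum; under eq_bigr do rewrite patch_set0.
by rewrite sumr_const -[LHS]mulr_natl.
Qed.

Lemma cavg_set0 w f s : 0 < w s -> cavg w set0 f s = f s.
Proof.
move=> w0; have n0 : #|{: {ffun V -> S}}|%:R != 0 :> R.
  by rewrite pnatr_eq0 -lt0n; apply/card_gt0P; exists s.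
rewrite /cavg !resum_set0; field.
by rewrite n0 gt_eqF.
Qed.

Section PositiveWeight.
Variable w : {ffun V -> S} -> R.
Hypothesis w0 : forall s, 0 < w s.

Lemma resum_gt0 D F s : (forall r, 0 < F r) -> 0 < resum D F s.
Proof.
move=> F0; rewrite /resum (bigD1 s) //= ltr_wpDr // sumr_ge0 // => r _.
exact: ltW.
Qed.

Lemma cavg_gt0 D f s : (forall r, 0 < f r) -> 0 < cavg w D f s.
Proof. by move=> f0; rewrite divr_gt0 ?resum_gt0 // => r; rewrite mulr_gt0. Qed.

Lemma cavg_adjoint D g f : off_invariant D g ->
  \sum_s w s * (g s * cavg w D f s) = \sum_s w s * (g s * f s).
Proof.
move=> hg.
transitivity (\sum_s \sum_r w s * g s / resum D w s * (w (patch D s r) * f (patch D s r))).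
  apply: eq_bigr => s _; rewrite -mulr_sumr /cavg /resum; ring.
rewrite -(sum_patch_swap D); apply: eq_bigr => s _.
transitivity (\sum_r w (patch D s r) * (g s / resum D w s * (w s * f s))).
  apply: eq_bigr => r _; rewrite patch_swapK hg resum_invariant; ring.
rewrite -mulr_suml -/(resum D w s); field.
by rewrite gt_eqF ?resum_gt0.
Qed.

Lemma cavg_adjoint_weight m D g f :
  off_invariant D m -> off_invariant D g ->
  \sum_s m s * w s * (g s * cavg w D f s) = \sum_s m s * w s * (g s * f s).
Proof.
move=> hm hg; have hmg : off_invariant D (fun s => m s * g s) by move=> s r; rewrite hm hg.
have := cavg_adjoint f hmg; congr (_ = _); apply: eq_bigr => s _; ring.
Qed.

(** The difference of the two sides is constant in the spins of D', and adjointness makes it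
    orthogonal to every such function, hence to itself. *)
Lemma cavg_tower D D' f s : D \subset D' ->
  cavg w D' (cavg w D f) s = cavg w D' f s.
Proof.
move=> sD; apply/eqP; rewrite -subr_eq0 -sqrf_eq0; apply/eqP.
pose g r := cavg w D' (cavg w D f) r - cavg w D' f r.
have gD' : off_invariant D' g by move=> r r'; rewrite /g !cavg_invariant.
have gD : off_invariant D g := off_invariant_sub sD gD'.
have e0 : \sum_r w r * g r ^+ 2 = 0.
  transitivity (\sum_r w r * (g r * cavg w D' (cavg w D f) r)
                - \sum_r w r * (g r * cavg w D' f r)).
    by rewrite -sumrB; apply: eq_bigr => r _; rewrite -mulrBr -mulrBr expr2.
  by rewrite !cavg_adjoint // subrr.
have h r : true -> 0 <= w r * g r ^+ 2 by rewrite mulr_ge0 ?sqr_ge0 // ltW.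
have /eqP := psumr_eq0P h e0 (isT : (fun _ => true) s).
by rewrite mulf_eq0 gt_eqF //= => /eqP.
Qed.

End PositiveWeight.
End Patch.

(** * Entropy of block averages *)

Section BlockEntropy.
Variables (V : finType) (S : finType) (R : realType).
Implicit Types (D U : {set V}) (s r : {ffun V -> S}) (m w f t : {ffun V -> S} -> R).

(* Entropy of f lost by averaging over the spins in D, for the measure of weight
   [m s * w s]; m is constant in the spins of D in all uses, so that [cavg w D] is
   also the conditional expectation for [m * w]. *)
Definition block_entropy m w f D : R :=
  \sum_s m s * w s * (f s * (ln (f s) - ln (cavg w D f s))).

Lemma bregman_cavg w D f t s : (forall s, 0 < w s) -> (forall s, 0 < f s) ->
  (forall s, 0 < t s) ->
  bregman (cavg w D f s) (cavg w D t s) <= cavg w D (fun r => bregman (f r) (t r)) s.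
Proof.
move=> w0 f0 t0; have n0 : 0 < resum D w s := resum_gt0 D s w0.
rewrite /cavg ![_ / resum D w s]mulrC bregmanM ?invr_gt0 //; last 2 first.
- by apply: resum_gt0 => r; rewrite mulr_gt0.
- by apply: resum_gt0 => r; rewrite mulr_gt0.
rewrite ler_pM2l ?invr_gt0 //.
by apply: (@bregman_sum _ _ predT (fun r => w (patch D s r)) (fun r => f (patch D s r))
  (fun r => t (patch D s r))) => // r _; rewrite ltW.
Qed.

Section PositiveWeight.
Variables (m w f : {ffun V -> S} -> R).
Hypotheses (m0 : forall s, 0 <= m s) (w0 : forall s, 0 < w s) (f0 : forall s, 0 < f s).

Lemma cavg_mass D : off_invariant D m ->
  \sum_s m s * w s * cavg w D f s = \sum_s m s * w s * f s.
Proof.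
move=> hm; have := cavg_adjoint_weight w0 (g := fun=> 1) f hm (fun _ _ => erefl).
by under eq_bigr do rewrite mul1r; under [RHS]eq_bigr do rewrite mul1r.
Qed.

Lemma cavg_adjoint_sub D D' g : D \subset D' -> off_invariant D' m -> off_invariant D' g ->
  \sum_s m s * w s * (g s * cavg w D f s) = \sum_s m s * w s * (g s * f s).
Proof.
by move=> sD hm hg; apply: cavg_adjoint_weight => //; apply: off_invariant_sub sD _.
Qed.

(** Both averages have the mass of f, so the linear terms of [bregman] come for free; the drop
    becomes a sum of nonnegative terms, open to Jensen. *)
Lemma block_entropyB D D' : D \subset D' -> off_invariant D' m ->
  block_entropy m w f D' - block_entropy m w f D =
  \sum_s m s * w s * bregman (cavg w D f s) (cavg w D' f s).
Proof.
move=> sD hm; have hm' := off_invariant_sub sD hm.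
have hg : off_invariant D (fun s => ln (cavg w D f s) - ln (cavg w D' f s)).
  move=> s r; rewrite cavg_invariant; congr (_ - ln _).
  exact: (off_invariant_sub sD (@cavg_invariant _ _ _ w D' f)).
transitivity (\sum_s m s * w s * ((ln (cavg w D f s) - ln (cavg w D' f s)) * f s)).
  by rewrite /block_entropy -sumrB; apply: eq_bigr => s _; ring.
rewrite -(cavg_adjoint_weight w0 f hm' hg).
rewrite -[LHS]addr0 -[X in _ + X](subrr (\sum_s m s * w s * f s)).
rewrite -{1}(cavg_mass hm) -(cavg_mass hm') -sumrB -big_split /=.
by apply: eq_bigr => s _; rewrite /bregman; ring.
Qed.

Lemma block_entropy_mono D D' : D \subset D' -> off_invariant D' m ->
  block_entropy m w f D <= block_entropy m w f D'.
Proof.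
move=> sD hm; rewrite -subr_ge0 block_entropyB // sumr_ge0 // => s _.
by rewrite mulr_ge0 ?mulr_ge0 ?(ltW (w0 _)) ?bregman_ge0 ?cavg_gt0.
Qed.

(** Pythagoras for relative entropy: since [ln (cavg w D' f s) - ln (t s)] is constant in the spins
    of D', the excess of the right side is the sum of [bregman (cavg w D' f s) (t s)]. *)
Lemma bregman_cavg_min D D' t : D \subset D' -> off_invariant D' m ->
  off_invariant D' t -> (forall s, 0 < t s) ->
  \sum_s m s * w s * bregman (cavg w D f s) (cavg w D' f s) <=
  \sum_s m s * w s * bregman (cavg w D f s) (t s).
Proof.
move=> sD hm ht t0; rewrite -subr_ge0.
have hg : off_invariant D' (fun s => ln (cavg w D' f s) - ln (t s)).
  by move=> s r; rewrite cavg_invariant ht.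
rewrite (_ : _ - _ = \sum_s m s * w s * bregman (cavg w D' f s) (t s)).
  rewrite sumr_ge0 // => s _.
  by rewrite mulr_ge0 ?mulr_ge0 ?(ltW (w0 _)) ?bregman_ge0 ?cavg_gt0.
transitivity (\sum_s m s * w s * ((ln (cavg w D' f s) - ln (t s)) * cavg w D f s)
   - \sum_s m s * w s * cavg w D' f s + \sum_s m s * w s * t s).
  by rewrite -!sumrB -big_split /=; apply: eq_bigr => s _; rewrite /bregman; ring.
rewrite (cavg_adjoint_sub sD hm hg) -(cavg_adjoint_sub (fintype.subxx D') hm hg).
by rewrite -!sumrB -big_split /=; apply: eq_bigr => s _; rewrite /bregman; ring.
Qed.

End PositiveWeight.

Section Uniform.
Local Notation one := (fun=> 1).

Lemma resum_one D s : resum D one s = #|{: {ffun V -> S}}|%:R :> R.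
Proof. by rewrite /resum sumr_const. Qed.

Lemma uavg_uavg D D' f s :
  cavg one D (cavg one D' f) s = cavg one (D :|: D') f s.
Proof.
have n0 : #|{: {ffun V -> S}}|%:R != 0 :> R.
  by rewrite pnatr_eq0 -lt0n; apply/card_gt0P; exists s.
rewrite /cavg !resum_one.
have -> : resum D (fun r => 1 * (resum D' (fun r' => 1 * f r') r / resum D' one r)) s
  = #|{: {ffun V -> S}}|%:R^-1 * resum D (resum D' (fun r' => 1 * f r')) s.
  by rewrite /resum mulr_sumr; apply: eq_bigr => r _; rewrite sumr_const mul1r mulrC.
by rewrite resum_resum; field.
Qed.

(** Under the uniform weight, averaging over D2 after D1 is averaging over their union. The averages
    on the left are thus D2-averages of those on the right, and Jensen for [bregman] concludes. For
    a general weight averages do not compose in this way. *)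
Lemma block_entropy_submod m f D1 D2 U : (forall s, 0 <= m s) -> (forall s, 0 < f s) ->
  D1 \subset D2 -> off_invariant (D2 :|: U) m ->
  block_entropy m one f (D2 :|: U) - block_entropy m one f D2 <=
  block_entropy m one f (D1 :|: U) - block_entropy m one f D1.
Proof.
move=> m0 f0 sD hm; have o0 (s : {ffun V -> S}) : 0 < 1 :> R by [].
have sDU : D1 :|: U \subset D2 :|: U by exact: setSU.
have hmD2 : off_invariant D2 m by apply: off_invariant_sub hm; exact: subsetUl.
rewrite !block_entropyB ?subsetUl //; last exact: off_invariant_sub hm.
pose F r := bregman (cavg one D1 f r) (cavg one (D1 :|: U) f r).
have -> : \sum_s m s * 1 * bregman (cavg one D1 f s) (cavg one (D1 :|: U) f s)
   = \sum_s m s * 1 * cavg one D2 F s.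
  by rewrite cavg_mass.
apply: ler_sum => s _; rewrite ler_wpM2l ?mulr1 //.
have e2 : D2 = D2 :|: D1 by apply/esym/setUidPl.
have e3 : D2 :|: U = D2 :|: (D1 :|: U) by rewrite setUA -e2.
rewrite {1}e3 {1}e2 -!uavg_uavg.
by apply: bregman_cavg => // r; exact: cavg_gt0.
Qed.

End Uniform.
End BlockEntropy.

(** * Block factorization for random sets *)

Section BernoulliSets.
Variables (V : finType) (R : realType).
Implicit Types (A B U : {set V}) (x y : V) (theta : R) (F : {set V} -> R).

Definition bernoulli_wt theta B : R := theta ^+ #|B| * (1 - theta) ^+ #|~: B|.

Lemma bernoulli_wt_ge0 theta B : 0 <= theta <= 1 -> 0 <= bernoulli_wt theta B.
Proof. by case/andP=> h0 h1; rewrite mulr_ge0 ?exprn_ge0 ?subr_ge0. Qed.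

Lemma prod_if_set A (a b : R) :
  \prod_i (if i \in A then a else b) = a ^+ #|A| * b ^+ #|~: A|.
Proof.
rewrite (bigID (mem A)) /=; congr (_ * _).
  by under eq_bigr => i -> do []; rewrite prodr_const.
under eq_bigr => i /negbTE -> do [].
by rewrite -prodr_const; apply: eq_bigl => i; rewrite inE.
Qed.

Lemma bernoulli_wt_superset theta A :
  \sum_(B : {set V} | A \subset B) bernoulli_wt theta B = theta ^+ #|A|.
Proof.
transitivity (\prod_(i : V) (theta + (if i \in A then 0 else 1 - theta))); last first.
  rewrite (eq_bigr (fun i => if i \in A then theta else 1)); last first.
    by move=> i _; case: ifP; rewrite ?addr0 // addrC subrK.
  by rewrite prod_if_set expr1n mulr1.
rewrite bigA_distr.
rewrite [RHS](bigID (fun B : {set V} => A \subset B)) /= [X in _ + X]big1 ?addr0 => [|J].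
  apply: eq_bigr => J sAJ; rewrite /bernoulli_wt -prod_if_set; apply: eq_bigr => i _.
  by case: ifPn => // nJ; rewrite ifN //; apply: contra nJ; exact: (fintype.subsetP sAJ).
case/subsetPn => x xA xJ; apply/eqP/prodf_eq0; exists x => //.
by rewrite (negbTE xJ) xA.
Qed.

Lemma card_layer m : #|[pred A : {set V} | #|A| == m]| = 'C(#|V|, m).
Proof.
rewrite -cardsT -cards_draws -cardsE; apply: eq_card => A.
by rewrite !in_set finset.subsetT.
Qed.

Lemma sum_layer_remove m F :
  \sum_(B : {set V} | #|B| == m.+1) \sum_(x in B) F (B :\ x) =
  (#|V| - m)%:R * \sum_(B : {set V} | #|B| == m) F B.
Proof.
rewrite (exchange_big_dep predT) //=.
transitivity (\sum_x \sum_(B : {set V} | (#|B| == m) && (x \notin B)) F B).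
  apply: eq_bigr => x _.
  rewrite (reindex_onto (fun B => x |: B) (fun B => B :\ x)) /=; last first.
    by move=> B /andP[_ xB]; rewrite setD1K.
  apply: eq_big => [B|B /andP[_ /eqP ->] //].
  case: (boolP (x \in B)) => xB; last by rewrite setU1K // eqxx !inE eqxx cardsU1 xB eqSS andbT.
  rewrite andbF; apply/negbTE; rewrite negb_and; apply/orP; right.
  by apply/eqP => e; have := setD11 x (x |: B); rewrite e xB.
rewrite (exchange_big_dep (fun B : {set V} => #|B| == m)) /= => [|x B _ /andP[]//].
rewrite mulr_sumr; apply: eq_bigr => B /eqP cB.
rewrite (eq_bigl (mem (~: B))); last by move=> x; rewrite cB eqxx !inE.
by rewrite sumr_const -[LHS]mulr_natl cardsCs setCK cB.
Qed.

Lemma bernoulli_wt_mono theta (F G : {set V} -> R) : 0 <= theta <= 1 ->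
  (forall m, (m <= #|V|)%N ->
     \sum_(B : {set V} | #|B| == m) F B <= \sum_(B : {set V} | #|B| == m) G B) ->
  \sum_B bernoulli_wt theta B * F B <= \sum_B bernoulli_wt theta B * G B.
Proof.
move=> ht h.
have E H : \sum_B bernoulli_wt theta B * H B = \sum_(m < #|V|.+1)
   theta ^+ m * (1 - theta) ^+ (#|V| - m) * \sum_(B : {set V} | #|B| == m) H B.
  rewrite (partition_big (fun B : {set V} => inord #|B| : 'I_#|V|.+1) predT) //=.
  apply: eq_bigr => m _; rewrite mulr_sumr; apply: eq_big => [B|B].
    by rewrite -val_eqE /= inordK // ltnS max_card.
  rewrite -val_eqE /= inordK ?ltnS ?max_card // => /eqP e.
  by rewrite /bernoulli_wt (cardsCs (~: B)) setCK e.
rewrite !E; apply: ler_sum => m _; rewrite ler_wpM2l ?h -1?ltnS //.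
by case/andP: ht => t0 t1; rewrite mulr_ge0 ?exprn_ge0 ?subr_ge0.
Qed.

Section Factorization.
Variables (h : {set V} -> R) (c : R) (a : nat).
Hypothesis h0 : h set0 = 0.
Hypothesis hmono : forall A B, A \subset B -> h A <= h B.
Hypothesis hpair : forall B, 0 <=
  \sum_(x in B) \sum_(y in B :\ x) (h (B :\ x) + h (B :\ y) - h B - h (B :\ x :\ y))
  + c * \sum_(x in B) (h B - h (B :\ x)).
Hypotheses (ca : c + 1 <= a%:R) (a0 : (0 < a)%N).

Let n := #|V|.
Let layer m : R := \sum_(B : {set V} | #|B| == m) h B.
Let avg m : R := layer m / 'C(n, m)%:R.

Let bin_neq0 m : (m <= n)%N -> 'C(n, m)%:R != 0 :> R.
Proof. by move=> mn; rewrite pnatr_eq0 -lt0n bin_gt0. Qed.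

Let layerE m : (m <= n)%N -> layer m = 'C(n, m)%:R * avg m.
Proof. by move=> /bin_neq0 e; rewrite /avg mulrC divfK. Qed.

Let binS m : ((n - m)%:R * 'C(n, m)%:R = m.+1%:R * 'C(n, m.+1)%:R :> R).
Proof. by rewrite -!natrM mul_bin_left. Qed.

Let h_ge0 B : 0 <= h B.
Proof. by rewrite -h0 hmono // finset.sub0set. Qed.

Let avg_ge0 m : 0 <= avg m.
Proof. by rewrite divr_ge0 // sumr_ge0. Qed.

Let sum_diff m : \sum_(B : {set V} | #|B| == m.+1) \sum_(x in B) (h B - h (B :\ x))
  = m.+1%:R * layer m.+1 - (n - m)%:R * layer m.
Proof.
rewrite -sum_layer_remove mulr_sumr -sumrB; apply: eq_bigr => B /eqP cB.
by rewrite sumrB sumr_const cB -[h B *+ _]mulr_natl.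
Qed.

Let avg_mono m : (m < n)%N -> avg m <= avg m.+1.
Proof.
move=> mn; have : 0 <= m.+1%:R * layer m.+1 - (n - m)%:R * layer m.
  rewrite -sum_diff sumr_ge0 // => B _; rewrite sumr_ge0 // => x _.
  by rewrite subr_ge0 hmono // subD1set.
rewrite !layerE ?(ltnW mn) // mulrA mulrA [X in _ - X * _]binS -mulrBr.
by rewrite pmulr_rge0 ?subr_ge0 // mulr_gt0 // ltr0n bin_gt0.
Qed.

(** [hpair] summed over the sets of size m + 2: sums over removed vertices become sums over lower
    layers, and all binomial factors reduce to a common positive one. *)
Let avg_pair m : (m.+2 <= n)%N ->
  0 <= m.+1%:R * (2 * avg m.+1 - avg m.+2 - avg m) + c * (avg m.+2 - avg m.+1).
Proof.
move=> mn.
have : 0 <= \sum_(B : {set V} | #|B| == m.+2) (\sum_(x in B) \sum_(y in B :\ x)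
   (h (B :\ x) + h (B :\ y) - h B - h (B :\ x :\ y))
    + c * \sum_(x in B) (h B - h (B :\ x))).
  by rewrite sumr_ge0.
rewrite big_split /= -mulr_sumr sum_diff.
rewrite (eq_bigr (fun B : {set V} => m.+1%:R * 2 * \sum_(x in B) h (B :\ x)
   - m.+2%:R * m.+1%:R * h B - \sum_(x in B) \sum_(y in B :\ x) h (B :\ x :\ y))); last first.
  move=> B /eqP cB.
  have cx x : x \in B -> #|B :\ x| = m.+1.
    by move=> xB; move: cB; rewrite (cardsD1 x) xB => -[].
  have e1 : \sum_(x in B) \sum_(y in B :\ x) h (B :\ x) = m.+1%:R * \sum_(x in B) h (B :\ x).
    by rewrite mulr_sumr; apply: eq_bigr => x xB; rewrite sumr_const cx // -[LHS]mulr_natl.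
  have e2 : \sum_(x in B) \sum_(y in B :\ x) h (B :\ y) = m.+1%:R * \sum_(x in B) h (B :\ x).
    rewrite -e1 (exchange_big_dep (mem B)) /= => [|x y _]; last by rewrite inE => /andP[].
    apply: eq_bigr => x xB; apply: eq_bigl => y.
    by rewrite !inE xB andbT andbC eq_sym.
  have e3 : \sum_(x in B) \sum_(y in B :\ x) h B = m.+2%:R * m.+1%:R * h B.
    rewrite (eq_bigr (fun=> m.+1%:R * h B)) => [|x xB].
      by rewrite sumr_const cB -[LHS]mulr_natl mulrA.
    by rewrite sumr_const cx // -[LHS]mulr_natl.
  rewrite (eq_bigr (fun x => \sum_(y in B :\ x) h (B :\ x) + \sum_(y in B :\ x) h (B :\ y)
     - \sum_(y in B :\ x) h B - \sum_(y in B :\ x) h (B :\ x :\ y))); last first.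
    by move=> x _; rewrite !sumrB big_split.
  rewrite !sumrB big_split /= e1 e2 e3; congr (_ - _ - _).
  by rewrite [RHS]mulrAC [RHS]mulr_natr mulr2n.
rewrite !sumrB -!mulr_sumr sum_layer_remove.
rewrite (sum_layer_remove m.+1 (fun C => \sum_(y in C) h (C :\ y))) sum_layer_remove.
rewrite -/(layer m.+2) -/(layer m.+1) -/(layer m) -/n.
rewrite !layerE ?(ltnW mn) //; last by apply: leq_trans mn; rewrite leqW.
have E1 := binS m.+1; have E2 := binS m.
have Q0 : 0 < m.+2%:R * 'C(n, m.+2)%:R :> R by rewrite mulr_gt0 // ltr0n bin_gt0.
set p := (n - m.+1)%:R in E1 *; set q := (n - m)%:R in E2 *.
set c2 := 'C(n, m.+2)%:R in E1 Q0 *; set c1 := 'C(n, m.+1)%:R in E1 E2 *.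
set k0 := 'C(n, m)%:R in E2 *.
have -> : p * (q * (k0 * avg m)) = m.+1%:R * (m.+2%:R * c2) * avg m.
  by rewrite -E1 [q * _]mulrA E2; ring.
have -> : p * (c1 * avg m.+1) = m.+2%:R * c2 * avg m.+1 by rewrite -E1; ring.
set M1 := m.+1%:R; set M2 := m.+2%:R in Q0 *.
rewrite [X in 0 <= X -> _](_ : _ = M2 * c2 * (M1 * (2 * avg m.+1 - avg m.+2 - avg m)
   + c * (avg m.+2 - avg m.+1))); last by ring.
by rewrite pmulr_rge0.
Qed.

(* [avg m / 'C(m, a)] is nonincreasing in m; this form is the one that passes
   through the induction. *)
Let avg_growth m : (m < n)%N -> m.+1%:R * (avg m.+1 - avg m) <= a%:R * avg m.+1.
Proof.
elim: m => [_|m IH mn].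
  have e0 : avg 0 = 0.
    rewrite /avg /layer (big_pred1 set0) ?h0 ?mul0r // => B; exact: cards_eq0.
  by rewrite e0 subr0 ler_wpM2r ?avg_ge0 // ler1n.
have := IH (ltnW mn); have := avg_pair mn; have d0 := avg_mono mn.
set M := m.+1%:R; have -> : m.+2%:R = M + 1 :> R by rewrite -natr1.
(* The newest increment has coefficient c + 1: c from the pair inequality and 1 from m + 2 = M + 1.
   The right side gains a times the same increment. *)
have : 0 <= (a%:R - (c + 1)) * (avg m.+2 - avg m.+1) by rewrite mulr_ge0 ?subr_ge0.
move: (avg m) (avg m.+1) (avg m.+2) => u v w; lra.
Qed.

Let avg_bin k : (k <= n)%N -> 'C(k, a)%:R * avg n <= 'C(n, a)%:R * avg k.
Proof.
move=> kn; have [j jn ->] : exists2 j, (j <= n)%N & k = (n - j)%N.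
  by exists (n - k)%N; rewrite ?leq_subr ?subKn.
elim: j jn => [|j IH] jn; first by rewrite subn0.
have {IH} := IH (ltnW jn).
have -> : (n - j = (n - j.+1).+1)%N by rewrite subnSK.
set i := (n - j.+1)%N => IH.
have iN : (i < n)%N by rewrite /i; case: (n) jn => // p _; rewrite subSS ltnS leq_subr.
have [ia|ai] := ltnP i a; first by rewrite bin_small // mul0r mulr_ge0 ?avg_ge0.
have e : i.+1%:R * 'C(i, a)%:R = (i.+1 - a)%:R * 'C(i.+1, a)%:R :> R.
  by rewrite -!natrM -mul_bin_down.
have g := avg_growth iN.
rewrite -(@ler_pM2l _ i.+1%:R) // mulrA e.
have sa : (i.+1 - a)%:R = i.+1%:R - a%:R :> R by rewrite natrB // leqW.
apply: le_trans (_ : (i.+1 - a)%:R * ('C(n, a)%:R * avg i.+1) <= _).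
  by rewrite -mulrA ler_wpM2l.
have : 0 <= 'C(n, a)%:R * (a%:R * avg i.+1 - i.+1%:R * (avg i.+1 - avg i)).
  by rewrite mulr_ge0 // subr_ge0.
rewrite sa; lra.
Qed.

(** Each set of size a lies in B with probability theta^a, so 'C(#|B|, a) has mean theta^a 'C(n, a).
    It remains to compare layer by layer: the average of h over sets of size m is at least h setT
    times 'C(m, a) / 'C(n, a). *)
Lemma bernoulli_block_factorization theta : 0 <= theta <= 1 ->
  theta ^+ a * h setT <= \sum_B bernoulli_wt theta B * h B.
Proof.
move=> ht; have /andP[t0 t1] := ht.
have hn : avg n = h setT.
  rewrite /avg binn divr1 /layer (big_pred1 setT) // => B /=.
  apply/eqP/eqP => [e|->]; last by rewrite cardsT.
    by apply/eqP; rewrite eqEcard finset.subsetT cardsT -/n -e leqnn.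
(* If n < a the binomials vanish, but the single term B = setT has weight theta^n >= theta^a. *)
have [na|an] := ltnP n a.
  rewrite (bigD1 setT) //= [X in X + _](_ : _ = theta ^+ n * h setT); last first.
    by rewrite /bernoulli_wt cardsT setCT cards0 expr0 mulr1.
  rewrite -[X in X <= _]addr0 lerD ?sumr_ge0 // => [|B _].
    by rewrite ler_wpM2r // ler_wiXn2l // ltnW.
  by rewrite mulr_ge0 ?bernoulli_wt_ge0.
have c0 : 0 < 'C(n, a)%:R :> R by rewrite ltr0n bin_gt0.
have -> : theta ^+ a * h setT =
   \sum_B bernoulli_wt theta B * ('C(#|B|, a)%:R * (h setT / 'C(n, a)%:R)).
  transitivity (\sum_(B : {set V}) \sum_(A : {set V} | (A \subset B) && (#|A| == a))
       bernoulli_wt theta B * (h setT / 'C(n, a)%:R)); last first.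
    apply: eq_bigr => B _; rewrite sumr_const -[LHS]mulr_natl [RHS]mulrCA -cards_draws cardsE.
    by congr (_%:R * _).
  rewrite (exchange_big_dep (fun A : {set V} => #|A| == a)) /= => [|B A _ /andP[]//].
  transitivity (\sum_(A : {set V} | #|A| == a) theta ^+ a * (h setT / 'C(n, a)%:R)).
    rewrite sumr_const -[RHS]mulr_natl.
    have -> : #|[pred A : {set V} | #|A| == a]| = 'C(n, a).
      exact: card_layer.
    by field; rewrite gt_eqF.
  apply: eq_bigr => A /eqP cA; rewrite -mulr_suml; congr (_ * _).
  by rewrite -{1}cA -bernoulli_wt_superset; apply: eq_bigl => B; rewrite cA eqxx andbT.
apply: bernoulli_wt_mono => // m mn.
rewrite -/(layer m) layerE //.
rewrite (eq_bigr (fun=> 'C(m, a)%:R * (h setT / 'C(n, a)%:R))); last by move=> B /eqP ->.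
rewrite sumr_const -[X in X <= _]mulr_natl.
have -> : #|[pred A : {set V} | #|A| == m]| = 'C(n, m).
  exact: card_layer.
rewrite ler_wpM2l // mulrA ler_pdivrMr // -hn [X in _ <= X]mulrC.
exact: avg_bin.
Qed.

End Factorization.
End BernoulliSets.

(** * Clusters of random sets *)

Section Clusters.
Variables (V : finType) (e : rel V) (Delta : nat).
Hypothesis e_sym : symmetric e.
Hypothesis e_deg : forall x, (#|[set z | e x z]| <= Delta)%N.
Implicit Types (B D U : {set V}) (u v x y z : V).

Definition rel_in D : rel V := fun x y => [&& x \in D, y \in D & e x y].

Definition cluster D v : {set V} := [set x | connect (rel_in D) v x].

Lemma rel_in_sym D : symmetric (rel_in D).
Proof. by move=> x y; rewrite /rel_in e_sym andbCA. Qed.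

Lemma mem_cluster D v : v \in cluster D v.
Proof. by rewrite inE connect0. Qed.

Lemma cluster_sub D v : v \in D -> cluster D v \subset D.
Proof.
move=> vD; apply/fintype.subsetP => x; rewrite inE => c.
have cl : fingraph.closed (rel_in D) D by move=> a b /and3P[aD bD _]; rewrite aD bD.
by rewrite -(closed_connect cl c).
Qed.

Lemma cluster_nonadj D v u z : v \in D -> u \in cluster D v ->
  z \in D :\: cluster D v -> ~~ e u z.
Proof.
move=> vD uC; rewrite in_setD => /andP[zC zD]; apply: contra zC => euz.
have uD := fintype.subsetP (cluster_sub vD) _ uC.
move: uC; rewrite !inE => c; apply: connect_trans c _; apply: connect1.
by rewrite /rel_in uD zD.
Qed.

(** A path starting in the cluster stays in it, so it survives restriction to the cluster: a cluster
    is connected as seen from any of its vertices. *)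
Lemma cluster_cluster D v y : v \in D -> y \in cluster D v ->
  cluster (cluster D v) y = cluster D v.
Proof.
move=> vD yC; set C := cluster D v in yC *.
have CD : C \subset D := cluster_sub vD.
have up (a b : V) : a \in C -> connect (rel_in D) a b -> connect (rel_in C) a b.
  move=> aC /connectP[p pp ->].
  elim: p a aC pp => [|b' p IH] a aC /=; first by rewrite connect0.
  case/andP=> ab pp.
  have bC : b' \in C by move: aC; rewrite !inE => c; apply: connect_trans c (connect1 ab).
  apply: connect_trans (IH _ bC pp); apply: connect1.
  by case/and3P: ab => _ _ eab; rewrite /rel_in aC bC.
have down (a b : V) : connect (rel_in C) a b -> connect (rel_in D) a b.
  apply: connect_sub => c d /and3P[cC dC ecd]; apply: connect1.
  by rewrite /rel_in !(fintype.subsetP CD) // ecd.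
have csym : connect_sym (rel_in D) := sym_connect_sym (@rel_in_sym D).
have yv : connect (rel_in D) v y by move: yC; rewrite inE.
apply/setP => x; rewrite in_set [RHS]in_set; apply/idP/idP => [/down|] c.
  exact: connect_trans yv c.
by apply: up => //; apply: connect_trans c; rewrite csym.
Qed.

Definition closed_nbhd U : {set V} := U :|: \bigcup_(u in U) [set z | e u z].

Lemma card_closed_nbhd U : (#|closed_nbhd U| <= Delta.+1 * #|U|)%N.
Proof.
apply: leq_trans (leq_card_setU _ _) _; rewrite mulSn leq_add2l.
have : (#|\bigcup_(u in U) [set z | e u z]| <= \sum_(u in U) #|[set z | e u z]|)%N.
  apply: (big_ind2 (fun (A : {set V}) m => #|A| <= m)%N) => [|A a B b hA hB|//].
    by rewrite cards0.
  by apply: leq_trans (leq_card_setU _ _) _; exact: leq_add.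
move/leq_trans; apply; rewrite mulnC -sum_nat_const; exact: leq_sum.
Qed.

Lemma cluster_nbhd U (C : {set V}) y : cluster U y = U -> C \subset ~: closed_nbhd U ->
  cluster (U :|: C) y = U.
Proof.
move=> cU sC; have yU : y \in U by rewrite -cU mem_cluster.
apply/setP => x; apply/idP/idP; rewrite in_set => c.
  have cl : fingraph.closed (rel_in (U :|: C)) U.
    have half (a b : V) : rel_in (U :|: C) a b -> a \in U -> b \in U.
      case/and3P => _; rewrite inE => /orP[//|bC] eab aU.
      have := fintype.subsetP sC _ bC; rewrite !inE negb_or => /andP[_ /bigcupP[]].
      by exists a; rewrite ?inE.
    move=> a b ab; apply/idP/idP; first exact: half ab.
    by apply: half; rewrite rel_in_sym.
  by rewrite -(closed_connect cl c).
move: c; rewrite -{1}cU in_set; apply: connect_sub => a b /and3P[aU bU eab].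
by apply: connect1; rewrite /rel_in !inE aU bU.
Qed.

Variable R : realType.

(* The clusters of y in all subsets of V: a given connected U is the cluster of
   y in at least 2 ^ (#|V| - #|closed_nbhd U|) of them. *)
Lemma sum_clusters_le1 y :
  \sum_(U : {set V} | cluster U y == U) (2 ^+ Delta.+1)^-1 ^+ #|U| <= 1 :> R.
Proof.
have N0 : 0 < 2 ^+ #|V| :> R by rewrite exprn_gt0.
rewrite -(ler_pM2l N0) mulr1 mulr_sumr.
rewrite [X in _ <= X](_ : _ = \sum_(U : {set V}) #|[set B | cluster B y == U]|%:R); last first.
  rewrite -natr_sum -natrX; congr _%:R.
  transitivity #|{: {set V}}|.
    by rewrite -cardsT -card_powerset; apply: eq_card => A; rewrite !inE finset.subsetT.
  rewrite -sum1_card (partition_big (fun B => cluster B y) predT) //=.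
  by apply: eq_bigr => U _; rewrite sum1dep_card.
rewrite [X in X <= _]big_mkcond; apply: ler_sum => U _; case: ifP => // /eqP cU.
have : (2 ^ #|~: closed_nbhd U| <= #|[set B | cluster B y == U]|)%N.
  rewrite -card_powerset -(@card_in_imset _ _ (fun C => U :|: C)); last first.
    move=> C1 C2; rewrite !inE => h1 h2 e12.
    have d (C : {set V}) : C \subset ~: closed_nbhd U -> (U :|: C) :\: U = C.
      move=> h; rewrite setDUl setDv set0U; apply/setDidPl.
      rewrite disjoints_subset;
 apply: fintype.subset_trans h _.
      by rewrite finset.setCS subsetUl.
    by rewrite -(d C1 h1) e12 d.
  apply: subset_leq_card; apply/fintype.subsetP => B /imsetP[C]; rewrite !inE => h ->.
  by rewrite cluster_nbhd.
rewrite -(ler_nat R); apply: le_trans.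
rewrite natrX exprVn -exprM ler_pdivrMr ?exprn_gt0 // -exprD ler_eXn2l ?ltr1n //.
by rewrite -(cardsC (closed_nbhd U)) addnC leq_add2l card_closed_nbhd.
Qed.

End Clusters.

(** * Increments along an ordering of the vertices *)

Section PrefixSums.
Variables (V : finType) (R : realType).
Implicit Types (B D U Z : {set V}) (u v x y z : V) (k : {set V} -> R).

Definition prefix B v : {set V} := [set x in B | (enum_rank x < enum_rank v)%N].

Definition gain k y B : R := k (y |: B) - k B.

Lemma prefix_telescope k B : k set0 = 0 ->
  k B = \sum_(v in B) gain k v (prefix B v).
Proof.
move=> k0; pose T i : {set V} := [set x in B | (enum_rank x < i)%N].
have TB : T #|V| = B by apply/setP => x; rewrite inE ltn_ord andbT.
have T0 : T 0 = set0 by apply/setP => x; rewrite !inE ltn0 andbF.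
transitivity (k (T #|V|) - k (T 0%N)); first by rewrite TB T0 k0 subr0.
rewrite -(@telescope_sumr _ 0 #|V| (fun i => k (T i))) // big_mkord.
rewrite (reindex (@enum_rank V)) /=; last first.
  by exists enum_val => x _; rewrite ?enum_rankK ?enum_valK.
rewrite [RHS]big_mkcond; apply: eq_bigr => v _.
have [vB|vB] := boolP (v \in B).
  congr (k _ - _); apply/setP => x; rewrite !inE ltnS leq_eqVlt andb_orr.
  rewrite val_eqE (inj_eq enum_rank_inj); congr (_ || _).
  by case: eqP => [->|]; rewrite ?vB ?andbF.
suff -> : T (enum_rank v).+1 = T (enum_rank v) by rewrite subrr.
apply/setP => x; rewrite !inE ltnS leq_eqVlt andb_orr val_eqE (inj_eq enum_rank_inj).
by case: eqP => [->|]; rewrite ?(negbTE vB) ?andbF.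
Qed.

Lemma gain_sum_ge k U Z :
  (forall D1 D2 y, D1 \subset D2 -> gain k y D2 <= gain k y D1) ->
  k (U :|: Z) - k Z <= \sum_(y in U) gain k y Z.
Proof.
move=> ksub; rewrite (@prefix_telescope (fun X => k (X :|: Z) - k Z)) ?set0U ?subrr //.
apply: ler_sum => y _; apply: le_trans (ksub Z (prefix U y :|: Z) y (subsetUr _ _)).
by rewrite /gain !setUA; lra.
Qed.

End PrefixSums.

Section Percolation.
Variables (V : finType) (e : rel V) (Delta : nat) (R : realType).
Hypothesis e_sym : symmetric e.
Hypothesis e_deg : forall x, (#|[set z | e x z]| <= Delta)%N.
Variables (h k : {set V} -> R) (c theta : R).
Hypotheses (h0 : h set0 = 0) (k0 : k set0 = 0).
Hypothesis hmono : forall A B : {set V}, A \subset B -> h A <= h B.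
Hypothesis kmono : forall A B : {set V}, A \subset B -> k A <= k B.
Hypothesis ksub : forall (A B : {set V}) y, A \subset B -> gain k y B <= gain k y A.
Hypothesis c0 : 0 <= c.
Hypothesis hk : forall U Z : {set V}, [disjoint U & Z] ->
  (forall u z, u \in U -> z \in Z -> ~~ e u z) ->
  h (U :|: Z) - h Z <= c ^+ #|U| * (k (U :|: Z) - k Z).
Hypothesis theta01 : 0 < theta < 1.
Hypothesis theta_small : c * (theta / (1 - theta)) <= (2 ^+ Delta.+1)^-1.
Implicit Types (B D U Z : {set V}) (u v x y z : V).

Let t0 : 0 < theta. Proof. by case/andP: theta01. Qed.
Let t1 : 0 < 1 - theta. Proof. by case/andP: theta01 => _; rewrite subr_gt0. Qed.
Let w_ge0 B : 0 <= bernoulli_wt theta B.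
Proof. by rewrite bernoulli_wt_ge0 // ltW //= -subr_ge0 ltW. Qed.
Let gain_ge0 y B : 0 <= gain k y B.
Proof. by rewrite subr_ge0 kmono // subsetUr. Qed.

Let conn y U := cluster e U y == U.
Let G U y B := c ^+ #|U| * gain k y (prefix (B :\: U) y).
Let G_ge0 U y B : 0 <= G U y B.
Proof. by rewrite mulr_ge0 ?exprn_ge0. Qed.

Let clus B v := cluster e (v |: prefix B v) v.

Let prefix_sub B v : v \in B -> v |: prefix B v \subset B.
Proof.
by move=> vB; apply/fintype.subsetP => x; rewrite !inE => /orP[/eqP->|/andP[]].
Qed.

Let clus_sub B v : clus B v \subset v |: prefix B v.
Proof. by apply: cluster_sub; rewrite !inE eqxx. Qed.

(* Adding v to the vertices of B before it completes the cluster U of v; as h is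
   monotone, the gain is at most that of adding all of U to the other clusters,
   none of which is adjacent to U. *)
Let gain_cluster B v : v \in B ->
  gain h v (prefix B v) <= \sum_(y in clus B v) G (clus B v) y B.
Proof.
move=> vB; set U := clus B v; set D := v |: prefix B v.
have vD : v \in D by rewrite !inE eqxx.
have vU : v \in U := mem_cluster e D v.
have UD : U \subset D := clus_sub B v.
pose Z := D :\: U.
have DU : U :|: Z = D.
  apply/setP => x; rewrite in_setU in_setD.
  by have [/(fintype.subsetP UD) ->|] := boolP (x \in U).
have Zp : Z \subset prefix B v.
  apply/fintype.subsetP => x; rewrite in_setD => /andP[xU]; rewrite in_setU1.
  by case/orP=> // /eqP xv; rewrite xv vU in xU.
have dUZ : [disjoint U & Z] by rewrite disjoint_sym; apply/setDidPl; rewrite setDDl finset.setUid.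
have nadj u z : u \in U -> z \in Z -> ~~ e u z.
  by move=> uU zZ; apply: cluster_nonadj vD uU zZ.
have -> : gain h v (prefix B v) = h (U :|: Z) - h (prefix B v) by rewrite DU.
apply: le_trans (_ : h (U :|: Z) - h Z <= _); first by rewrite lerB ?hmono.
apply: le_trans (hk dUZ nadj) _; rewrite -mulr_sumr ler_wpM2l ?exprn_ge0 //.
apply: le_trans (gain_sum_ge U Z ksub) _; apply: ler_sum => y yU.
(* As y ranks no higher than v, the vertices of B outside U that precede y all lie in Z. *)
apply: ksub; apply/fintype.subsetP => x; rewrite !inE => /andP[/andP[xU xB] xy].
rewrite xU xB /=; apply/orP; right; apply: leq_trans xy _.
have := fintype.subsetP UD _ yU; rewrite !inE => /orP[/eqP->//|/andP[_ /ltnW//]].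
Qed.

(** The vertex v is recovered as the one of largest rank in its cluster. *)
Let clus_inj B : {in B &, injective (clus B)}.
Proof.
have max v u : u \in clus B v -> (enum_rank u <= enum_rank v)%N.
  move=> /(fintype.subsetP (clus_sub B v)); rewrite !inE.
  by case/orP=> [/eqP->//|/andP[_ /ltnW]].
move=> v w vB wB evw; apply: enum_rank_inj; apply: val_inj; apply/eqP.
rewrite eqn_leq !max //; first by rewrite evw mem_cluster.
by rewrite -evw mem_cluster.
Qed.

(** The clusters that occur are replaced by all connected subsets U of B; nonnegative terms allow
    the overcounting. After that U no longer depends on B, and the two sums can be exchanged. *)
Let h_le_clusters B :
  h B <= \sum_(U : {set V} | U \subset B) \sum_(y in U | conn y U) G U y B.
Proof.
rewrite (prefix_telescope B h0).
pose F U := \sum_(y in U | conn y U) G U y B.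
have F0 U : 0 <= F U by rewrite sumr_ge0.
apply: le_trans (_ : \sum_(v in B) F (clus B v) <= _).
  apply: ler_sum => v vB; apply: le_trans (gain_cluster vB) _.
  rewrite le_eqVlt; apply/orP; left; apply/eqP; apply: eq_bigl => y.
  have [yU|//] := boolP (y \in clus B v); rewrite /conn /= /clus.
  by rewrite (cluster_cluster e_sym) ?eqxx // !inE eqxx.
rewrite -(big_imset F (@clus_inj B)) /= [X in X <= _]big_mkcond [X in _ <= X]big_mkcond.
apply: ler_sum => U _; case: ifP => [/imsetP[v vB ->]|_]; last by case: ifP => // _; exact: F0.
rewrite ifT //; apply: fintype.subset_trans (clus_sub B v) _; exact: prefix_sub.
Qed.

(* B is replaced by (B :\: U) with y put back; B is recovered by adding U. *)
Let sum_superset U y : y \in U ->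
  \sum_(B : {set V} | U \subset B) bernoulli_wt theta B * gain k y (prefix (B :\: U) y) <=
  (theta / (1 - theta)) ^+ #|U|.-1 *
    \sum_(B : {set V} | y \in B) bernoulli_wt theta B * gain k y (prefix B y).
Proof.
move=> yU; rewrite (reindex_onto (fun B => B :|: U) (fun B => y |: (B :\: U))) /=; last first.
  move=> B UB; apply/setP => x; rewrite !inE.
  have [xU|xU] := boolP (x \in U); first by rewrite orbT (fintype.subsetP UB).
  rewrite orbF /=; case: (x =P y) => [xy|//].
  by rewrite xy yU in xU.
rewrite mulr_sumr [X in X <= _]big_mkcond [X in _ <= X]big_mkcond /=.
apply: ler_sum => B _; case: ifPn => [/andP[_ /eqP eB]|_]; last first.
  by case: ifP => // _; apply: mulr_ge0; [apply: exprn_ge0; apply: divr_ge0; apply: ltW | apply: mulr_ge0].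
have yB : y \in B by rewrite -eB !inE eqxx.
rewrite yB; set X := B :|: U.
have -> : prefix (X :\: U) y = prefix B y.
  rewrite -[in RHS]eB; apply/setP => x; rewrite !inE.
  by case: (x =P y) => [->|//]; rewrite ltnn !andbF.
rewrite mulrA ler_wpM2r //.
have dBU : B :&: U = [set y].
  apply/setP => x; rewrite -eB !inE.
  by case: (x =P y) => [->|//]; rewrite ?yU //=; case: (x \in U); rewrite ?andbF.
have cU : #|U| = #|U|.-1.+1 by rewrite prednK // (cardD1 y) yU.
have cX : #|X| = (#|B| + #|U|.-1)%N.
  have := cardsUI B U; rewrite dBU cards1 cU -/X => /eqP.
  by rewrite addn1 addnS eqSS => /eqP.
have cC : #|~: B| = (#|~: X| + #|U|.-1)%N.
  have := cardsC B; have := cardsC X; lia.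
rewrite /bernoulli_wt cX cC !exprD expr_div_n le_eqVlt; apply/orP; left; apply/eqP.
by field; rewrite expf_neq0 // gt_eqF.
Qed.

(** The factor c^|U| and the power |U| - 1 from [sum_superset] combine to c 2^(Delta+1) times the
    |U|-th power of 2^-(Delta+1), which [sum_clusters_le1] sums over U. The surplus 2^(Delta+1) is
    due to y staying in the random set. *)
Lemma bernoulli_cluster_comparison :
  \sum_B bernoulli_wt theta B * h B <=
  c * 2 ^+ Delta.+1 * \sum_B bernoulli_wt theta B * k B.
Proof.
pose S y := \sum_(B : {set V} | y \in B) bernoulli_wt theta B * gain k y (prefix B y).
have S0 y : 0 <= S y by rewrite sumr_ge0 // => B _; rewrite mulr_ge0.
have -> : \sum_B bernoulli_wt theta B * k B = \sum_y S y.
  rewrite [RHS](exchange_big_dep predT) //=; apply: eq_bigr => B _.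
  by rewrite (prefix_telescope B k0) mulr_sumr.
apply: le_trans (_ : \sum_B bernoulli_wt theta B *
  (\sum_(U : {set V} | U \subset B) \sum_(y in U | conn y U) G U y B) <= _).
  by apply: ler_sum => B _; rewrite ler_wpM2l.
have -> : \sum_B bernoulli_wt theta B *
    (\sum_(U : {set V} | U \subset B) \sum_(y in U | conn y U) G U y B) =
  \sum_(U : {set V}) \sum_(y in U | conn y U) c ^+ #|U| *
    \sum_(B : {set V} | U \subset B) bernoulli_wt theta B * gain k y (prefix (B :\: U) y).
  under eq_bigr do rewrite mulr_sumr.
  rewrite (exchange_big_dep predT) //=; apply: eq_bigr => U _.
  under eq_bigr do rewrite mulr_sumr.
  rewrite exchange_big /=; apply: eq_bigr => y _.
  by rewrite mulr_sumr; apply: eq_bigr => B _; rewrite /G; ring.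
apply: le_trans (_ : \sum_(U : {set V}) \sum_(y in U | conn y U)
   c * 2 ^+ Delta.+1 * (2 ^+ Delta.+1)^-1 ^+ #|U| * S y <= _).
  apply: ler_sum => U _; apply: ler_sum => y /andP[yU _].
  apply: le_trans (ler_wpM2l (exprn_ge0 _ c0) (sum_superset yU)) _.
  rewrite mulrA -/(S y) ler_wpM2r //.
  have -> : #|U| = #|U|.-1.+1 by rewrite prednK // (cardD1 y) yU.
  have a0 : 0 < 2 ^+ Delta.+1 :> R by rewrite exprn_gt0.
  have ts := theta_small; set a := 2 ^+ Delta.+1 in ts a0 *; rewrite !exprS /=.
  rewrite (mulrA _ a^-1) mulfK ?gt_eqF // -mulrA -exprMn ler_wpM2l //.
  rewrite lerXn2r // nnegrE ?invr_ge0 ?(ltW a0) //.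
  by apply: mulr_ge0 => //; apply: divr_ge0; apply: ltW.
rewrite (exchange_big_dep predT) //= mulr_sumr; apply: ler_sum => y _.
rewrite -mulr_suml ler_wpM2r // -mulr_sumr ler_piMr ?mulr_ge0 ?exprn_ge0 //.
apply: le_trans (sum_clusters_le1 e_sym e_deg R y).
rewrite [X in X <= _]big_mkcond [X in _ <= X]big_mkcond /=; apply: ler_sum => U _.
rewrite /conn; case: (y \in U) => //=.
by case: ifP => // _; rewrite exprn_ge0 // invr_ge0 exprn_ge0.
Qed.

End Percolation.

(** * The Edwards-Sokal coupling *)

Section EdwardsSokal.
Variables (R : realType) (V : finType) (E : {set {set V}}) (q : nat) (beta : R).
Implicit Types (s r : {ffun V -> 'I_q}) (A M : {set {set V}}) (D U Z : {set V}) (f : {ffun V -> 'I_q} -> R).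

Local Notation mu := (@gibbs R V E q beta).
Local Notation mono := (@mono_edges V E q).
Local Notation one := (fun=> 1).

Lemma sum_subsets_expr (T : finType) (M : {set T}) (x y : R) :
  \sum_(A : {set T} | A \subset M) x ^+ #|A| * y ^+ #|M :\: A| = (x + y) ^+ #|M|.
Proof.
transitivity (\prod_(i : T) ((if i \in M then x else 0) + (if i \in M then y else 1))); last first.
  rewrite (eq_bigr (fun i => if i \in M then x + y else 1)); last first.
    by move=> i _; case: ifP => _ //; rewrite add0r.
  by rewrite prod_if_set expr1n mulr1.
rewrite bigA_distr [RHS](bigID (fun A : {set T} => A \subset M)) /=.
rewrite [X in _ + X]big1 ?addr0 => [|A /subsetPn[z zA zM]]; last first.
  by apply/eqP/prodf_eq0; exists z => //; rewrite zA (negbTE zM).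
apply: eq_bigr => A sAM; rewrite [RHS](bigID (mem A)) /=; congr (_ * _).
  rewrite (eq_bigr (fun=> x)) ?prodr_const // => i iA.
  by rewrite iA (fintype.subsetP sAM _ iA).
rewrite [RHS](bigID (mem M)) /= [X in _ * X]big1 ?mulr1; last first.
  by move=> i /andP[/negbTE -> /negbTE ->].
rewrite (eq_bigr (fun=> y)); last by move=> i /andP[/negbTE -> ->].
by rewrite -prodr_const; apply: eq_bigl => i; rewrite in_setD.
Qed.

Definition partition_fun : R := \sum_(s : config V q) weight E beta s.

Hypothesis q0 : (0 < q)%N.

Lemma weight_gt0 s : 0 < weight E beta s.
Proof. exact: expR_gt0. Qed.

Lemma partition_fun_gt0 : 0 < partition_fun.
Proof.
pose s0 : config V q := [ffun=> Ordinal q0].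
rewrite /partition_fun (bigD1 s0) //= ltr_wpDr ?weight_gt0 // sumr_ge0 // => s _.
exact/ltW/weight_gt0.
Qed.

Lemma gibbs_gt0 s : 0 < mu s.
Proof. by rewrite divr_gt0 ?weight_gt0 ?partition_fun_gt0. Qed.

Lemma gibbs_sum1 : \sum_s mu s = 1.
Proof. by rewrite -mulr_suml divff // gt_eqF // partition_fun_gt0. Qed.

Lemma mono_edge_eq s r (e : {set V}) : {in e, s =1 r} ->
  (e \in mono s) = (e \in mono r).
Proof.
move=> h; rewrite !inE; congr (_ && _).
apply/forall_inP/forall_inP => H x xe; apply/forall_inP => y ye.
  by have /forall_inP/(_ y ye) := H x xe; rewrite !h.
by have /forall_inP/(_ y ye) := H x xe; rewrite !h.
Qed.

Definition isolated A : {set V} := [set x | [forall e in A, x \notin e]].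

(* Joint weight of (sigma, A) in the Edwards-Sokal coupling. *)
Definition es_weight A s : R :=
  partition_fun^-1 * (if A \subset mono s then (expR beta - 1) ^+ #|A| else 0).

Lemma isolatedP A x (e : {set V}) : x \in isolated A -> e \in A -> x \notin e.
Proof. by rewrite inE => /forall_inP; apply. Qed.

Lemma es_weight_invariant A : off_invariant (isolated A) (es_weight A).
Proof.
move=> s r; rewrite /es_weight.
suff -> : (A \subset mono (patch (isolated A) s r)) = (A \subset mono s) by [].
suff h e : e \in A -> (e \in mono (patch (isolated A) s r)) = (e \in mono s).
  by apply/fintype.subsetP/fintype.subsetP => H e eA; move: (H e eA); rewrite h.
move=> eA; apply: mono_edge_eq => x xe; rewrite ffunE; case: ifP => // xA.
by have := isolatedP xA eA; rewrite xe.
Qed.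

Hypothesis beta0 : 0 < beta.

Lemma expR_sub1_gt0 : 0 < expR beta - 1.
Proof. by rewrite subr_gt0 -expR0 ltr_expR. Qed.

Lemma es_weight_ge0 A s : 0 <= es_weight A s.
Proof.
rewrite mulr_ge0 ?invr_ge0 ?(ltW partition_fun_gt0) //.
by case: ifP => // _; rewrite exprn_ge0 // ltW // expR_sub1_gt0.
Qed.

Lemma sum_es_weight_sub M s : M \subset mono s ->
  \sum_(A : {set {set V}} | A \subset M) es_weight A s = partition_fun^-1 * expR (beta * #|M|%:R).
Proof.
move=> sM; rewrite -mulr_sumr; congr (_ * _).
have := sum_subsets_expr M (expR beta - 1) 1.
rewrite subrK -expRM_natr => <-; apply: eq_bigr => A sA.
by rewrite expr1n mulr1 ifT //; apply: fintype.subset_trans sM.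
Qed.

Lemma sum_es_weight s : \sum_A es_weight A s = mu s.
Proof.
rewrite /gibbs mulrC -/partition_fun /weight -(@sum_es_weight_sub (mono s) s) //.
rewrite [LHS](bigID (fun A => A \subset mono s)) /= [X in _ + X]big1 ?addr0 //.
by move=> A /negbTE nA; rewrite /es_weight nA mulr0.
Qed.

Section Comparison.
Variable f : {ffun V -> 'I_q} -> R.
Hypothesis f0 : forall s, 0 < f s.

Definition gibbs_entropy D : R := block_entropy one mu f D.

(** Given A, the weight [es_weight A] is constant in the isolated spins, so it takes the place of m
    and the resampling weight is one. This uniformity is what gives submodularity. *)
Definition isolated_entropy D : R :=
  \sum_A block_entropy (es_weight A) one f (D :&: isolated A).

Let inv_sub A D : off_invariant (D :&: isolated A) (es_weight A).
Proof. by apply: off_invariant_sub (@es_weight_invariant A); exact: subsetIr. Qed.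

Lemma isolated_entropy0 : isolated_entropy set0 = 0.
Proof.
rewrite /isolated_entropy big1 // => A _; rewrite set0I /block_entropy big1 // => s _.
by rewrite cavg_set0 // subrr mulr0 mulr0.
Qed.

Lemma gibbs_entropy0 : gibbs_entropy set0 = 0.
Proof.
rewrite /gibbs_entropy /block_entropy big1 // => s _.
by rewrite cavg_set0 ?gibbs_gt0 // subrr mulr0 mulr0.
Qed.

Lemma gibbs_entropy_mono D D' : D \subset D' -> gibbs_entropy D <= gibbs_entropy D'.
Proof. by move=> sD; apply: block_entropy_mono => //; exact: gibbs_gt0. Qed.

Lemma isolated_entropy_mono D D' : D \subset D' ->
  isolated_entropy D <= isolated_entropy D'.
Proof.
move=> sD; apply: ler_sum => A _; apply: block_entropy_mono => //.
- by move=> s; exact: es_weight_ge0.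
- exact: setSI.
Qed.

Lemma isolated_entropy_submod D D' y : D \subset D' ->
  gain isolated_entropy y D' <= gain isolated_entropy y D.
Proof.
move=> sD; rewrite /gain /isolated_entropy -!sumrB; apply: ler_sum => A _.
have e B : (y |: B) :&: isolated A = (B :&: isolated A) :|: ([set y] :&: isolated A).
  by rewrite setIUl setUC.
rewrite !e; apply: block_entropy_submod => //.
- by move=> s; exact: es_weight_ge0.
- exact: setSI.
- by rewrite -e.
Qed.

End Comparison.
End EdwardsSokal.

(** * Comparison of the two entropies on non-adjacent sets *)

Section BlockComparison.
Variables (R : realType) (V : finType) (E : {set {set V}}) (q : nat) (beta : R).
Implicit Types (s r : {ffun V -> 'I_q}) (A : {set {set V}}) (x y z u : V).
Hypothesis q0 : (0 < q)%N.
Hypothesis beta0 : 0 < beta.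
Hypothesis simpleE : simple_graph E.

Local Notation mu := (@gibbs R V E q beta).
Local Notation mono := (@mono_edges V E q).
Local Notation one := (fun=> 1).
Local Notation es := (@es_weight R V E q beta).

Lemma adj_sym (A : {set {set V}}) : symmetric (adj A).
Proof. by move=> x y; rewrite /adj finset.setUC. Qed.

Lemma edge_ends (e : {set V}) x y : e \in E -> x \in e -> y \in e -> x != y -> e = [set x; y].
Proof.
move=> eE xe ye xy; apply/esym/eqP; rewrite eqEcard (simpleE eE) cards2 xy andbT.
by apply/fintype.subsetP => z; rewrite !inE => /orP[] /eqP->.
Qed.

Lemma adj_degree x : (#|[set z | adj E x z]| <= max_degree E)%N.
Proof.
apply: leq_trans (_ : #|[set e in E | x \in e]| <= _)%N; last first.
  exact: (leq_bigmax x).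
rewrite -(@card_in_imset _ _ (fun z => [set x; z])); last first.
  move=> z1 z2; rewrite !inE /adj => h1 h2 e12.
  have := congr1 (fun D : {set V} => z1 \in D) e12; rewrite !inE eqxx orbT => /esym/orP[/eqP zx|/eqP//].
  by have := simpleE h1; rewrite zx finset.setUid cards1.
apply: subset_leq_card; apply/fintype.subsetP => e /imsetP[z]; rewrite inE => h ->.
by rewrite inE -/(adj E x z) h !inE eqxx.
Qed.

Definition edges_at (U : {set V}) : {set {set V}} := [set e in E | [exists x in U, x \in e]].

Lemma card_edges_at U : (#|edges_at U| <= max_degree E * #|U|)%N.
Proof.
apply: leq_trans (_ : \sum_(x in U) #|[set e in E | x \in e]| <= _)%N; last first.
  rewrite mulnC -sum_nat_const; apply: leq_sum => x _; exact: (leq_bigmax x).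
apply: leq_trans (_ : #|\bigcup_(x in U) [set e in E | x \in e]| <= _)%N.
  apply: subset_leq_card; apply/fintype.subsetP => e.
  by rewrite inE => /andP[eE /exists_inP[x xU xe]]; apply/bigcupP; exists x => //; rewrite inE eE.
apply: (big_ind2 (fun (A : {set {set V}}) m => #|A| <= m)%N) => [|A a B b hA hB|//].
  by rewrite cards0.
by apply: leq_trans (leq_card_setU _ _) _; exact: leq_add.
Qed.

Variable c : R.
Hypothesis cdeg : expR (beta * (max_degree E)%:R) <= c.

Variable f : {ffun V -> 'I_q} -> R.
Hypothesis f0 : forall s, 0 < f s.

Section Blocks.
Variables U Z : {set V}.
Hypothesis dUZ : [disjoint U & Z].
Hypothesis nadj : forall u z, u \in U -> z \in Z -> ~~ adj E u z.

Let g s : R := expR (beta * #|mono s :&: edges_at U|%:R).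
Let I A := U \subset isolated A.
Let es' A s := es A s * g s.

Let g_le s : g s <= c ^+ #|U|.
Proof.
apply: le_trans (_ : expR (beta * (max_degree E * #|U|)%:R) <= _).
  rewrite ler_expR ler_pM2l // ler_nat; apply: leq_trans (card_edges_at U).
  by apply: subset_leq_card; exact: subsetIr.
by rewrite natrM mulrA expRM_natr lerXn2r // nnegrE ?expR_ge0 // (le_trans _ cdeg) ?expR_ge0.
Qed.

Let disjUZ x : x \in U -> x \in Z = false.
Proof.
by move=> xU; apply/negbTE; move: dUZ; rewrite disjoint_subset => /fintype.subsetP/(_ x xU).
Qed.

(** Non-adjacency enters here: an edge counted by g has an end in U, so it has no end in Z. *)
Let g_inv : off_invariant Z g.
Proof.
move=> s r; congr (expR (beta * #|pred_of_set _|%:R)).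
apply/setP => e; rewrite !in_setI; case: (boolP (e \in edges_at U)); rewrite ?andbF ?andbT //.
rewrite inE => /andP[eE /exists_inP[x xU xe]]; apply: mono_edge_eq => z ze.
rewrite ffunE; case: ifP => // zZ.
have xz : x != z by apply: contraTneq zZ => <-; rewrite disjUZ.
by have := nadj xU zZ; rewrite /adj -(edge_ends eE xe ze xz) eE.
Qed.

Let isolatedE A s : A \subset mono s -> I A = (A \subset mono s :\: edges_at U).
Proof.
move=> sA; apply/fintype.subsetP/fintype.subsetP => h.
  move=> e eA; rewrite in_setD (fintype.subsetP sA) // andbT inE negb_and.
  apply/orP; right; apply/negP => /exists_inP[x xU xe].
  by have := isolatedP (h x xU) eA; rewrite xe.
move=> x xU; rewrite inE; apply/forall_inP => e eA; apply/negP => xe.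
have := h e eA; rewrite in_setD => /andP[+ em]; rewrite inE => /negP; apply.
have : e \in E by move: em; rewrite inE => /andP[].
by move=> ->; apply/exists_inP; exists x.
Qed.

(** The sets A that isolate U range over the subsets of the monochromatic edges not meeting U; the
    sum of [es] over them lacks exactly the factor g. *)
Let es'_sum s : \sum_(A : {set {set V}} | I A) es' A s = mu s.
Proof.
rewrite -mulr_suml.
have -> : \sum_(A : {set {set V}} | I A) es A s =
    \sum_(A : {set {set V}} | A \subset mono s :\: edges_at U) es A s.
  rewrite [LHS]big_mkcond [RHS]big_mkcond; apply: eq_bigr => A _.
  have [sA|sA] := boolP (A \subset mono s); first by rewrite (isolatedE sA).
  by rewrite /es_weight (negbTE sA) mulr0 !if_same.
rewrite (sum_es_weight_sub _ (s := s)) ?subsetDl // -mulrA -expRD -mulrDr -natrD.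
rewrite /gibbs mulrC /weight -/partition_fun; congr (expR (beta * _%:R) * _).
by rewrite addnC cardsID.
Qed.

Let es'_ge0 A s : 0 <= es' A s.
Proof. by rewrite mulr_ge0 ?expR_ge0 // es_weight_ge0. Qed.

Let mix (F : {set {set V}} -> {ffun V -> 'I_q} -> R) s : R :=
  \sum_(A : {set {set V}} | I A) es' A s / mu s * F A s.

Let mu0 s : 0 < mu s. Proof. exact: gibbs_gt0. Qed.

Let mix_sum1 s : \sum_(A : {set {set V}} | I A) es' A s / mu s = 1.
Proof. by rewrite -mulr_suml es'_sum divff // gt_eqF. Qed.

Let mix_w_ge0 A s : 0 <= es' A s / mu s.
Proof. by rewrite divr_ge0 // ltW. Qed.

Let mix_gt0 F s : (forall A r, 0 < F A r) -> 0 < mix F s.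
Proof. by move=> F0; apply: wsum_gt0 => //; rewrite mix_sum1. Qed.

Let mixE F s : mu s * mix F s = \sum_(A : {set {set V}} | I A) es' A s * F A s.
Proof. by rewrite mulr_sumr; apply: eq_bigr => A _; field; rewrite gt_eqF. Qed.

Let a A := cavg one (Z :&: isolated A) f.
Let b A := cavg one (Z :&: isolated A :|: U) f.

Let a0 A s : 0 < a A s. Proof. by apply: cavg_gt0. Qed.
Let b0 A s : 0 < b A s. Proof. by apply: cavg_gt0. Qed.

Let resum_mix F s : resum Z (fun r => mu r * mix F r) s =
  \sum_(A : {set {set V}} | I A) resum Z (fun r => es' A r * F A r) s.
Proof.
by rewrite /resum exchange_big /=; apply: eq_bigr => r _; rewrite mixE.
Qed.

(** [es' A] is constant in the spins of Z isolated by A, so the average over Z absorbs the one over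
    [Z :&: isolated A]; the sum over A then restores mu. *)
Let cavg_mix_a s : cavg mu Z (mix a) s = cavg mu Z f s.
Proof.
rewrite /cavg resum_mix; congr (_ / _).
transitivity (\sum_(A : {set {set V}} | I A) resum Z (fun r => es' A r * f r) s); last first.
  by rewrite /resum exchange_big /=; apply: eq_bigr => r _; rewrite -es'_sum mulr_suml.
apply: eq_bigr => A _; set D := Z :&: isolated A.
have inv' : off_invariant D (es' A).
  move=> r r'; rewrite /es'; congr (_ * _).
    by apply: off_invariant_sub (@es_weight_invariant R V E q beta A) r r'; exact: subsetIr.
  by apply: off_invariant_sub g_inv r r'; exact: subsetIl.
have n0 : #|{: {ffun V -> 'I_q}}|%:R != 0 :> R.
  by rewrite pnatr_eq0 -lt0n; apply/card_gt0P; exists s.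
have := uavg_uavg Z D (fun r => es' A r * f r) s.
have -> : Z :|: D = Z by apply/setUidPl; exact: subsetIl.
rewrite /cavg !resum_one => /(mulIf (invr_neq0 n0)).
have -> : resum Z (fun r => 1 * (es' A r * f r)) s = resum Z (fun r => es' A r * f r) s.
  by apply: eq_bigr => r _; rewrite mul1r.
move=> <-; apply: eq_bigr => r _; rewrite mul1r /a /cavg mulrA; congr (_ / _).
by rewrite -resum_invM // /resum; apply: eq_bigr => r' _; ring.
Qed.

Let t := cavg mu Z (mix b).

(** This makes t a competitor in [bregman_cavg_min]. The factor g may depend on the spins of U but
    not on those of Z, so it leaves both resummations and cancels in the quotient; [es A] and [b A]
    are constant in the spins of U when A isolates U. *)
Let t_inv : off_invariant (Z :|: U) t.
Proof.
pose H F s := \sum_(A : {set {set V}} | I A) resum Z (fun r => es A r * F A r) s : R.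
have HE F s : resum Z (fun r => mu r * mix F r) s = H F s * g s.
  rewrite resum_mix mulr_suml; apply: eq_bigr => A _; rewrite mulrC -resum_invM //.
  by apply: eq_bigr => r _; rewrite /es'; ring.
have Hinv F : (forall A, I A -> off_invariant U (F A)) -> off_invariant (Z :|: U) (H F).
  move=> Finv s r; apply: eq_bigr => A IA; apply: eq_bigr => r' _.
  have -> : patch Z (patch (Z :|: U) s r) r' = patch U (patch Z s r') r.
    apply/ffunP => x; rewrite !ffunE inE; have [xU|xU] := boolP (x \in U).
      by rewrite disjUZ // orbT.
    by rewrite orbF; case: (x \in Z).
  rewrite Finv //; congr (_ * _).
  by apply: off_invariant_sub (@es_weight_invariant R V E q beta A) _ _.
pose H1 := H (fun _ => one).
have den s : resum Z mu s = H1 s * g s.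
  rewrite -HE; apply: eq_bigr => r _; rewrite mixE.
  by under eq_bigr do rewrite mulr1; rewrite es'_sum.
have tE s : t s = H b s / H1 s.
  rewrite /t /cavg HE den; have := resum_gt0 Z s mu0; rewrite den => d0.
  by rewrite invfM mulrACA divff ?mulr1 // gt_eqF // expR_gt0.
have binv A : I A -> off_invariant U (b A).
  by move=> _; apply: off_invariant_sub (@cavg_invariant _ _ _ _ _ _); exact: subsetUr.
by move=> s r; rewrite !tE (Hinv b binv) /H1 (Hinv (fun _ => one)).
Qed.

(* On the right only the edge sets A that leave all of U isolated are kept.
   Reweighting them by g, the conditional probability given sigma being 1 / g,
   turns the law of sigma back into mu at the cost c ^ #|U|; joint convexity of
   [bregman] then compares the two sides. *)
Lemma block_comparison :
  gibbs_entropy E beta f (U :|: Z) - gibbs_entropy E beta f Z <=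
  c ^+ #|U| * (isolated_entropy E beta f (U :|: Z) - isolated_entropy E beta f Z).
Proof.
have c0 : 0 <= c by rewrite (le_trans _ cdeg) ?expR_ge0.
have t0 s : 0 < t s by apply: cavg_gt0 => // r; exact: mix_gt0.
rewrite finset.setUC /gibbs_entropy block_entropyB ?subsetUl //.
apply: le_trans (bregman_cavg_min _ _ _ (subsetUl _ _) _ t_inv t0) _ => //.
under eq_bigr => s _ do rewrite mul1r -cavg_mix_a.
apply: le_trans (_ : \sum_s mu s * mix (fun A r => bregman (a A r) (b A r)) s <= _).
  pose G s := bregman (mix a s) (mix b s).
  apply: le_trans (_ : \sum_s mu s * cavg mu Z G s <= _).
    apply: ler_sum => s _; rewrite ler_wpM2l ?(ltW (mu0 _)) //.
    by apply: bregman_cavg => // r; exact: mix_gt0.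
  have := @cavg_mass _ _ _ one mu G mu0 Z (fun _ _ => erefl).
  under eq_bigr do rewrite mul1r; under [RHS]eq_bigr do rewrite mul1r.
  move=> ->; apply: ler_sum => s _; rewrite ler_wpM2l ?(ltW (mu0 _)) //.
  by apply: bregman_sum => //; rewrite mix_sum1.
under eq_bigr do rewrite mixE.
rewrite exchange_big /= /isolated_entropy -sumrB mulr_sumr [X in X <= _]big_mkcond.
apply: ler_sum => A _.
have sub : Z :&: isolated A \subset (Z :|: U) :&: isolated A by rewrite setSI // subsetUl.
have inv : off_invariant ((Z :|: U) :&: isolated A) (es A).
  by apply: off_invariant_sub (@es_weight_invariant R V E q beta A); exact: subsetIr.
case: ifP => IA; last first.
  rewrite mulr_ge0 ?exprn_ge0 // subr_ge0 block_entropy_mono // => s; exact: es_weight_ge0.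
rewrite block_entropyB // mulr_sumr; apply: ler_sum => s _.
have -> : (Z :|: U) :&: isolated A = Z :&: isolated A :|: U.
  by rewrite setIUl; congr (_ :|: _); apply/setIidPl.
rewrite mulr1 mulrA ler_wpM2r ?bregman_ge0 //.
by rewrite /es' mulrC ler_wpM2r ?es_weight_ge0.
Qed.

End Blocks.
End BlockComparison.

(** * Spectral independence *)

Section Rayleigh.
Variable R : rcfType.
Local Open Scope sesquilinear_scope.

Local Notation toC := (real_complex R).

Lemma real_complex_real (x : R) : toC x \is Num.real.
Proof. by rewrite realE -[0]/(toC 0) !lecR; exact: num_real. Qed.

(** S is complexified in order to be diagonalised unitarily. Being hermitian it has real
    eigenvalues, which are roots of the real characteristic polynomial, so the hypothesis bounds
    them all. *)
Lemma rayleigh_le n (S : 'M[R]_n) (eta : R) (v : 'rV[R]_n) : S^T = S ->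
  (forall l, eigenvalue S l -> l <= eta) ->
  (v *m S *m v^T) 0 0 <= eta * (v *m v^T) 0 0.
Proof.
move=> Ssym Seta; pose SC := map_mx toC S.
have conjM m1 m2 (M : 'M[R]_(m1, m2)) : map_mx Num.conj (map_mx toC M) = map_mx toC M.
  by apply/matrixP => i j; rewrite !mxE conj_Creal ?real_complex_real.
have SH : SC \is hermsymmx.
  apply/is_hermitianmxP; rewrite expr0 scale1r.
  apply/matrixP => i j; rewrite [RHS]mxE [in RHS]mxE /SC [LHS]mxE [X in _ = Num.conj X]mxE.
  by rewrite conj_Creal ?real_complex_real // -[in LHS]Ssym mxE.
have /orthomx_spectralP eS := hermitian_normalmx SH.
set P := spectralmx SC in eS; set d := spectral_diag SC in eS.
have Pu : P \is unitarymx by exact: spectral_unitarymx.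
rewrite (invmx_unitary Pu) in eS.
have dreal i : d 0 i \is Num.real by have /mxOverP := hermitian_spectral_diag_real SH; apply.
have PPt : P *m P^t* = 1%:M by apply/unitarymxP.
have PtP : P^t* *m P = 1%:M by rewrite -(invmx_unitary Pu) mulVmx // unitarymx_unit.
have deta i : d 0 i <= toC eta.
  have ed : d 0 i = toC (complex.Re (d 0 i)).
    by rewrite RRe_real.
  suff : eigenvalue SC (d 0 i).
    rewrite ed lecR eigenvalue_root_char -map_char_poly fmorph_root -eigenvalue_root_char.
    exact: Seta.
  apply/eigenvalueP; exists (row i P).
    rewrite {1}eS -row_mul !mulmxA PPt mul1mx.
    by rewrite row_mul row_diag_mx -scalemxAl -rowE.
  apply/eqP => r0; have := congr1 (row i) PPt; rewrite row_mul r0 mul0mx => /rowP /(_ i).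
  by rewrite !mxE eqxx => /eqP; rewrite eq_sym oner_eq0.
pose vC := map_mx toC v; pose w := vC *m P^t*.
have wt : w^t* = P *m vC^T.
  by rewrite /w trmx_mul map_mxM trmxCK /vC map_trmx conjM.
have e1 : toC ((v *m S *m v^T) 0 0) = \sum_i d 0 i * (w 0 i * (w 0 i)^*).
  transitivity ((w *m diag_mx d *m w^t*) 0 0).
    have -> : w *m diag_mx d *m w^t* = vC *m SC *m vC^T by rewrite wt /w {1}eS !mulmxA.
    by rewrite /vC /SC map_trmx -!map_mxM [RHS]mxE.
  rewrite mxE; apply: eq_bigr => i _; rewrite mul_mx_diag !mxE; ring.
have e2 : toC ((v *m v^T) 0 0) = \sum_i w 0 i * (w 0 i)^*.
  transitivity ((w *m w^t*) 0 0).
    by rewrite wt /w mulmxA -(mulmxA vC) PtP mulmx1 /vC map_trmx -map_mxM [RHS]mxE.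
  by rewrite mxE; apply: eq_bigr => i _; rewrite !mxE.
rewrite -lecR [toC (_ * _)]rmorphM /= e1 e2 mulr_sumr; apply: ler_sum => i _.
by rewrite ler_wpM2r // mul_conjC_ge0.
Qed.

End Rayleigh.

Section SpectralIndependence.
Variables (R : realType) (V : finType) (E : {set {set V}}) (q : nat) (beta : R).
Implicit Types (s r : {ffun V -> 'I_q}) (B : {set V}) (x y : V) (F : {ffun V -> 'I_q} -> R).
Hypothesis q0 : (0 < q)%N.

Local Notation mu := (@gibbs R V E q beta).

Let mu0 s : 0 < mu s. Proof. exact: gibbs_gt0. Qed.

Definition pin B s : pinning V q := [ffun x => if x \in B then None else Some (s x)].

Lemma agrees_pin B s r : agrees (pin B s) r = (r == patch B s r).
Proof.
apply/forallP/eqP => [h|-> x]; last by rewrite !ffunE; case: ifP.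
by apply/ffunP => x; rewrite ffunE; have := h x; rewrite ffunE; case: ifP => // _ /eqP.
Qed.

Lemma cavg_sum (I : finType) (w : {ffun V -> 'I_q} -> R) (c : I -> R) (G : I -> {ffun V -> 'I_q} -> R) D s :
  cavg w D (fun r => \sum_i c i * G i r) s = \sum_i c i * cavg w D (G i) s.
Proof.
rewrite /cavg /resum (eq_bigr (fun r => \sum_i c i * (w (patch D s r) * G i (patch D s r)))).
  rewrite exchange_big mulr_suml; apply: eq_bigr => i _.
  by rewrite mulrA mulr_sumr.
by move=> r _; rewrite mulr_sumr; apply: eq_bigr => i _; ring.
Qed.

Lemma pinned_expect B s F :
  \sum_r gibbs_pinned E beta (pin B s) r * F r = cavg mu B F s.
Proof.
pose I r : R := (agrees (pin B s) r)%:R.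
have Iinv : off_invariant B I.
  move=> r r'; rewrite /I !agrees_pin; congr (_%:R); congr nat_of_bool.
  apply/eqP/eqP => [h|->]; apply/ffunP => x; rewrite !ffunE; last by case: (x \in B).
  by have := congr1 (fun k : {ffun _} => k x) h; rewrite !ffunE; case: (x \in B).
have denE : prob mu (agrees (pin B s)) = \sum_r mu r * I r.
  rewrite /prob big_mkcond; apply: eq_bigr => r _; rewrite /I.
  by case: (agrees _ _); rewrite ?mulr1 ?mulr0.
have den0 : 0 < \sum_r mu r * I r.
  rewrite (bigD1 s) //= ltr_wpDr ?sumr_ge0 // => [r _|]; first by rewrite mulr_ge0 // ltW.
  by rewrite /I agrees_pin (_ : patch B s s = s) ?eqxx ?mulr1 //; apply/ffunP => x; rewrite ffunE if_same.
have -> : \sum_r gibbs_pinned E beta (pin B s) r * F r =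
   (\sum_r mu r * (I r * F r)) / \sum_r mu r * I r.
  rewrite mulr_suml; apply: eq_bigr => r _.
  rewrite /gibbs_pinned /cond_prob denE mulrAC; congr (_ / _).
  rewrite mulrA; congr (_ * _); rewrite /prob /I.
  case: (boolP (agrees _ r)) => ar.
    rewrite (big_pred1 r) ?mulr1 // => r' /=; rewrite inE.
    by case: (r' =P r) => [->|//]; exact: ar.
  rewrite mulr0 big_pred0 // => r' /=; rewrite inE.
  by case: (r' =P r) => [->|//]; exact: (negbTE ar).
rewrite -(cavg_adjoint mu0 F Iinv).
rewrite [X in X / _](_ : _ = (\sum_r mu r * I r) * cavg mu B F s).
  by rewrite mulrC mulKf // gt_eqF.
have key r : I r * cavg mu B F r = I r * cavg mu B F s.
  rewrite /I agrees_pin; case: eqP => [->|_]; last by rewrite !mul0r.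
  by rewrite cavg_invariant.
by rewrite mulr_suml; apply: eq_bigr => r _; rewrite key mulrA.
Qed.

Lemma pinned_prob B s (A : pred (config V q)) :
  prob (gibbs_pinned E beta (pin B s)) A = cavg mu B (fun r => (A r)%:R) s.
Proof.
rewrite -pinned_expect /prob big_mkcond; apply: eq_bigr => r _.
by case: (A r); rewrite ?mulr1 ?mulr0.
Qed.

Variables (eta : R) (B : {set V}) (s : {ffun V -> 'I_q}).

Let ind x (a : 'I_q) r : R := (r x == a)%:R.
Let P F := cavg mu B F s.

Let pinned_cond_prob (A A' : pred (config V q)) :
  cond_prob (gibbs_pinned E beta (pin B s)) A A' =
  P (fun r => (A r)%:R * (A' r)%:R) / P (fun r => (A' r)%:R).
Proof.
rewrite /cond_prob !pinned_prob; congr (_ / _); congr (cavg _ _ _ _).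
by apply/boolp.funext => r; rewrite -natrM mulnb.
Qed.

Hypothesis marg0 : forall x a, x \in B -> 0 < P (ind x a).
Hypothesis eta_max : forall l, eigenvalue (influence_mx E beta (pin B s)) l -> l <= eta.

Let T : finType := (free_vertex (pin B s) * 'I_q)%type.
Let W (i : T) := P (ind (val i.1) i.2).
Let Cov (i j : T) := if i.1 == j.1 then 0
  else P (fun r => ind (val i.1) i.2 r * ind (val j.1) j.2 r) - W i * W j.

Let freeB (x : free_vertex (pin B s)) : val x \in B.
Proof. by have := valP x; rewrite ffunE; case: ifP. Qed.

Let W0 i : 0 < W i. Proof. exact: marg0. Qed.

Let influenceE i j : influence E beta i j = Cov i j / W i.
Proof.
case: i j => [x a] [y a'] /=; rewrite /Cov /W /=; case: (x == y); first by rewrite mul0r.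
rewrite pinned_cond_prob pinned_prob mulrBl.
congr (_ / _ - _).
  by congr (cavg _ _ _ _); apply/boolp.funext => r; rewrite mulrC.
by rewrite mulrC mulKf // gt_eqF // (W0 (x, a)).
Qed.

Let covS i j : Cov i j = Cov j i.
Proof.
rewrite /Cov eq_sym; case: eqP => // _; rewrite [W i * _]mulrC; congr (_ - _).
by congr (cavg _ _ _ _); apply/boolp.funext => r; rewrite mulrC.
Qed.

Let ev (i : 'I_#|{: T}|) : T := enum_val i.
Let rt i := Num.sqrt (W (ev i)).
Let S : 'M[R]_(#|{: T}|) := \matrix_(i, j) (Cov (ev i) (ev j) / (rt i * rt j)).

Let rt0 i : 0 < rt i. Proof. by rewrite sqrtr_gt0. Qed.
Let rt2 i : rt i * rt i = W (ev i). Proof. by rewrite -expr2 sqr_sqrtr // ltW. Qed.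

(** The influence matrix is the symmetric matrix [Cov] with row i divided by [W i]. Conjugation by
    the square roots of W makes it the symmetric matrix S, and the eigenvalue bound becomes a bound
    on a quadratic form. *)
Let S_eigen l : eigenvalue S l -> l <= eta.
Proof.
case/eigenvalueP => v vS v0; apply: eta_max; apply/eigenvalueP.
exists (\row_j (v 0 j * rt j)); last first.
  apply: contra_neq v0 => u0; apply/rowP => j; have /rowP/(_ j) := u0.
  by rewrite !mxE => /eqP; rewrite mulf_eq0 (gt_eqF (rt0 j)) orbF => /eqP.
apply/rowP => j; have /rowP/(_ j) := vS; rewrite !mxE => e.
rewrite mulrA -e mulr_suml; apply: eq_bigr => i _; rewrite !mxE influenceE -/(ev _) -/(ev _).
rewrite -rt2; field; by rewrite !gt_eqF.
Qed.

Lemma influence_quadratic_form (phi : V -> 'I_q -> R) :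
  (forall x, x \in B -> P (fun r => phi x (r x)) = 0) ->
  \sum_(x in B) \sum_(y in B :\ x) P (fun r => phi x (r x) * phi y (r y))
    <= eta * \sum_(x in B) P (fun r => phi x (r x) ^+ 2).
Proof.
move=> phi0.
have Ssym : S^T = S by apply/matrixP => i j; rewrite !mxE covS [rt _ * _]mulrC.
pose ph (i : T) := phi (val i.1) i.2.
(* The factor [rt i] in the test vector cancels the normalisation of S, leaving covariances on one
   side and second moments on the other. *)
have := rayleigh_le (\row_i (rt i * ph (ev i))) Ssym S_eigen.
have phE x r : phi x (r x) = \sum_a phi x a * ind x a r.
  rewrite (bigD1 (r x)) //= /ind eqxx mulr1 big1 ?addr0 // => a.
  by rewrite eq_sym => /negbTE ->; rewrite mulr0.
have sumT (F : T -> R) : \sum_(i < #|{: T}|) F (ev i) = \sum_x \sum_a F (x, a).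
  by rewrite pair_bigA -(big_enum_val (fun i : T => F i)); apply: eq_bigr => -[].
have sumB (F : V -> R) : \sum_(x : free_vertex (pin B s)) F (val x) = \sum_(x in B) F x.
  rewrite (reindex_omap (val : free_vertex (pin B s) -> V) insub) /=; last first.
    by move=> x xB; rewrite insubT //= ffunE xB.
  by apply: eq_bigl => x; rewrite valK eqxx freeB.
have e1 x (psi : 'I_q -> R) : P (fun r => psi (r x)) = \sum_a psi a * P (ind x a).
  rewrite /P -cavg_sum; congr (cavg _ _ _ _); apply/boolp.funext => r.
  rewrite (bigD1 (r x)) //= /ind eqxx mulr1 big1 ?addr0 // => a.
  by rewrite eq_sym => /negbTE ->; rewrite mulr0.
have e2 x y : P (fun r => phi x (r x) * phi y (r y)) =
   \sum_a \sum_a' phi x a * phi y a' * P (fun r => ind x a r * ind y a' r).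
  rewrite pair_bigA /= /P -(cavg_sum _ (fun p => phi x p.1 * phi y p.2)
     (fun p r => ind x p.1 r * ind y p.2 r)).
  congr (cavg _ _ _ _); apply/boolp.funext => r; rewrite !phE big_distrlr pair_bigA /=.
  by apply: eq_bigr => p _; rewrite mulrACA.
have -> : (\row_i (rt i * ph (ev i)) *m (\row_i (rt i * ph (ev i)))^T) 0 0 =
    \sum_(x in B) P (fun r => phi x (r x) ^+ 2).
  rewrite mxE -sumB; under [RHS]eq_bigr do rewrite (e1 _ (fun a => phi _ a ^+ 2)).
  rewrite -(sumT (fun i => ph i ^+ 2 * W i)); apply: eq_bigr => i _.
  by rewrite !mxE -rt2; ring.
congr (_ <= _); rewrite mxE.
transitivity (\sum_j \sum_i ph (ev i) * ph (ev j) * Cov (ev i) (ev j)).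
  apply: eq_bigr => j _; rewrite !mxE mulr_suml; apply: eq_bigr => i _; rewrite !mxE.
  by field; rewrite !gt_eqF.
rewrite (sumT (fun j => \sum_i ph (ev i) * ph j * Cov (ev i) j)).
transitivity (\sum_(y : free_vertex (pin B s)) \sum_(x : free_vertex (pin B s))
   if x == y then 0 else P (fun r => phi (val x) (r (val x)) * phi (val y) (r (val y)))).
  apply: eq_bigr => y _.
  rewrite (eq_bigr (fun a' => \sum_x \sum_a ph (x, a) * ph (y, a') * Cov (x, a) (y, a'))); last first.
    by move=> a' _; rewrite (sumT (fun i => ph i * ph (y, a') * Cov i (y, a'))).
  rewrite exchange_big /=; apply: eq_bigr => x _; rewrite exchange_big /= /Cov /=.
  case: (x == y); first by rewrite big1 // => a _; rewrite big1 // => a' _; rewrite mulr0.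
  (* Centering removes the product of means from the covariance. *)
  have z : P (fun r => phi (val x) (r (val x))) * P (fun r => phi (val y) (r (val y))) = 0.
    by rewrite phi0 ?mul0r.
  rewrite e2 -[RHS]subr0 -[X in _ - X]z !e1 big_distrlr /= -sumrB; apply: eq_bigr => a _.
  by rewrite -sumrB; apply: eq_bigr => a' _; rewrite /ph /W /=; ring.
rewrite exchange_big /=.
rewrite -(sumB (fun x => \sum_(y in B :\ x) P (fun r => phi x (r x) * phi y (r y)))).
apply: eq_bigr => x _.
rewrite [RHS](eq_bigl (fun y => (y \in B) && (y != val x))); last by move=> y; rewrite !inE andbC.
rewrite big_mkcondr /=.
rewrite -(sumB (fun y => if y != val x then P (fun r => phi (val x) (r (val x)) * phi y (r y)) else 0)).
by apply: eq_bigr => y _; rewrite val_eqE eq_sym; case: (y == x).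
Qed.

End SpectralIndependence.

(** * Second differences of block entropies *)

Section PairInequality.
Variables (R : realType) (V S : finType) (b eta : R) (B : {set V}).
Variables (mu f : {ffun V -> S} -> R).
Implicit Types (s r : {ffun V -> S}) (x y : V).
Hypothesis mu0 : forall s, 0 < mu s.
Hypothesis f0 : forall s, 0 < f s.
Hypothesis eta0 : 0 <= eta.
Hypothesis b0 : 0 < b.
Hypothesis b1 : b <= 1.
Hypothesis marginal : forall s x a, x \in B -> b <= cavg mu B (fun r => (r x == a)%:R) s.
Hypothesis influence : forall s (phi : V -> S -> R),
  (forall x, x \in B -> cavg mu B (fun r => phi x (r x)) s = 0) ->
  \sum_(x in B) \sum_(y in B :\ x) cavg mu B (fun r => phi x (r x) * phi y (r y)) s
    <= eta * \sum_(x in B) cavg mu B (fun r => phi x (r x) ^+ 2) s.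

Local Notation one := (fun=> 1).

Let g D := cavg mu D f.
Let psi x s := g (B :\ x) s - g B s.

Let g0 D s : 0 < g D s. Proof. exact: cavg_gt0. Qed.

Let g_mass D : \sum_s mu s * g D s = \sum_s mu s * f s.
Proof.
have := @cavg_mass _ _ _ one mu f mu0 D (fun _ _ => erefl).
by under eq_bigr do rewrite mul1r; under [RHS]eq_bigr do rewrite mul1r.
Qed.

Let g_inv D : off_invariant D (g D). Proof. exact: cavg_invariant. Qed.

Let upd s x (a : S) := patch [set x] s [ffun=> a].

(** With the spins off B fixed, averaging over the rest of B forgets all but the spin of x. So psi
    is a one-site function, as [influence] requires. *)
Let psi_local s x r : x \in B ->
  psi x (patch B s r) = psi x (upd s x (patch B s r x)).
Proof.
move=> xB; set u := upd s x _.
have e1 : patch B s r = patch (B :\ x) u r.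
  by apply/ffunP => z; rewrite !ffunE !inE; case: eqP => [->|] //=; rewrite xB.
have e2 : patch B s r = patch B u r.
  apply/ffunP => z; rewrite !ffunE !inE; case: (boolP (z \in B)) => // zB.
  by case: eqP => // zx; rewrite zx xB in zB.
by rewrite /psi {1}e1 e2 !g_inv.
Qed.

Let cavg_eq s (F G : {ffun V -> S} -> R) :
  (forall r, F (patch B s r) = G (patch B s r)) -> cavg mu B F s = cavg mu B G s.
Proof. by move=> h; congr (_ / _); apply: eq_bigr => r _; rewrite h. Qed.

Let cavg_psi s x : cavg mu B (psi x) s = 0.
Proof.
have -> : cavg mu B (psi x) s = cavg mu B (g (B :\ x)) s - cavg mu B (g B) s.
  rewrite /cavg /resum -mulrBl -sumrB; congr (_ / _).
  by apply: eq_bigr => r _; rewrite -mulrBr.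
by rewrite (cavg_tower mu0 f s (subD1set B x)) (cavg_tower mu0 f s (fintype.subxx B)) subrr.
Qed.

Let cavg_sum_set (A : {set V}) (F : V -> {ffun V -> S} -> R) s :
  cavg mu B (fun r => \sum_(x in A) F x r) s = \sum_(x in A) cavg mu B (F x) s.
Proof.
rewrite /cavg -mulr_suml /resum exchange_big /=; congr (_ / _).
by apply: eq_bigr => r _; rewrite mulr_sumr.
Qed.

Let psi_pairs s : cavg mu B (fun r => \sum_(x in B) \sum_(y in B :\ x) psi x r * psi y r) s
  <= eta * cavg mu B (fun r => \sum_(x in B) psi x r ^+ 2) s.
Proof.
pose phi x a := psi x (upd s x a).
have psiE x r : x \in B -> psi x (patch B s r) = phi x (patch B s r x) by exact: psi_local.
have e1 x : x \in B -> cavg mu B (fun r => psi x r ^+ 2) s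
    = cavg mu B (fun r => phi x (r x) ^+ 2) s.
  by move=> xB; apply: cavg_eq => r; rewrite psiE.
have e2 x y : x \in B -> y \in B -> cavg mu B (fun r => psi x r * psi y r) s
    = cavg mu B (fun r => phi x (r x) * phi y (r y)) s.
  by move=> xB yB; apply: cavg_eq => r; rewrite !psiE.
have e3 x : x \in B -> cavg mu B (fun r => phi x (r x)) s = 0.
  by move=> xB; rewrite -(cavg_psi s x); apply: cavg_eq => r; rewrite -psiE.
have := influence e3.
rewrite (cavg_sum_set B (fun x r => psi x r ^+ 2)) (eq_bigr _ e1).
rewrite (cavg_sum_set B (fun x r => \sum_(y in B :\ x) psi x r * psi y r)).
rewrite [X in _ -> X <= _](eq_bigr (fun x => \sum_(y in B :\ x)
   cavg mu B (fun r => phi x (r x) * phi y (r y)) s)) // => x xB.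
rewrite (cavg_sum_set (B :\ x) (fun y r => psi x r * psi y r)).
by apply: eq_bigr => y; rewrite inE => /andP[_ yB]; exact: e2.
Qed.

(** g B is the mean of [g (B :\ x)] over B. Keep only the configurations in which x has its spin in
    s: they have conditional probability at least b. *)
Let g_le s x : x \in B -> g (B :\ x) s <= g B s / b.
Proof.
move=> xB; rewrite ler_pdivlMr //.
have -> : g B s = cavg mu B (g (B :\ x)) s by apply: esym; exact: (cavg_tower mu0 f s (subD1set B x)).
apply: le_trans (_ : cavg mu B (fun r => g (B :\ x) s * (r x == s x)%:R) s <= _).
  rewrite /cavg (_ : resum B _ s = g (B :\ x) s * resum B (fun r => mu r * (r x == s x)%:R) s).
    rewrite -mulrA ler_wpM2l ?(ltW (g0 _ _)) //; exact: marginal.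
  by rewrite /resum mulr_sumr; apply: eq_bigr => r _; ring.
rewrite /cavg ler_wpM2r ?invr_ge0 ?(ltW (resum_gt0 _ _ mu0)) //.
apply: ler_sum => r _; rewrite ler_wpM2l ?(ltW (mu0 _)) // ffunE xB.
case: eqP => [e|_]; last by rewrite mulr0 ltW.
have -> : patch B s r = patch (B :\ x) s r.
  by apply/ffunP => z; rewrite !ffunE !inE; case: eqP => [->|] //=; rewrite xB e.
by rewrite mulr1 g_inv.
Qed.

(** Both averages in the factor 2 (u + t) of [bregman_quadratic] are at most g B / b; hence the 4 /
    b, the origin of the term 4 eta / b in the growth exponent. *)
Let psi_sqr s x : x \in B ->
  psi x s ^+ 2 / g B s <= 4 / b * bregman (g (B :\ x) s) (g B s).
Proof.
move=> xB; rewrite ler_pdivrMr //; apply: le_trans (bregman_quadratic _ _) _ => //.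
rewrite [leRHS]mulrAC ler_wpM2r ?bregman_ge0 //.
have h := g_le s xB.
have h2 : g B s <= g B s / b by rewrite ler_pdivlMr // ler_piMr // ltW.
have -> : 4 / b * g B s = 2 * (g B s / b + g B s / b) by field; rewrite gt_eqF.
by rewrite ler_pM2l // lerD.
Qed.

Let mul_ln_ratio_ge (u v w z : R) : 0 < u -> 0 < v -> 0 < w -> 0 < z ->
  u - v * w / z <= (ln z + ln u - ln v - ln w) * u.
Proof.
move=> u0 v0 w0 z0; have t0 : 0 < v * w / z by rewrite divr_gt0 ?mulr_gt0.
have := bregman_ge0 u0 t0; rewrite /bregman ln_div ?lnM ?posrE ?mulr_gt0 //.
move=> h; rewrite -subr_ge0; apply: le_trans h _; rewrite le_eqVlt; apply/orP; left; apply/eqP; ring.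
Qed.

Local Notation h := (block_entropy one mu f).

Let pair_term x y :
  - (\sum_s mu s * (psi x s * psi y s / g B s)) <=
  h (B :\ x) + h (B :\ y) - h B - h (B :\ x :\ y).
Proof.
set D := B :\ x :\ y.
have Dx : D \subset B :\ x by exact: subD1set.
have Dy : D \subset B :\ y by rewrite /D setDDl finset.setUC -setDDl subD1set.
have DB : D \subset B by apply: fintype.subset_trans Dx _; exact: subD1set.
have inv (D' : {set V}) : D \subset D' -> off_invariant D (g D').
  by move=> sD; apply: off_invariant_sub sD _; exact: cavg_invariant.
(* All four averages are constant in the spins of D, so L may be integrated against g D instead of
   f. *)
pose L s := ln (g B s) + ln (g D s) - ln (g (B :\ x) s) - ln (g (B :\ y) s).
have Linv : off_invariant D L by move=> s r; rewrite /L !inv //.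
have -> : h (B :\ x) + h (B :\ y) - h B - h D = \sum_s mu s * (L s * g D s).
  rewrite (cavg_adjoint mu0 f Linv) /block_entropy.
  rewrite -big_split /= -!sumrB; apply: eq_bigr => s _; rewrite /L /g; ring.
have -> : - (\sum_s mu s * (psi x s * psi y s / g B s)) =
    \sum_s mu s * (g D s - g (B :\ x) s * g (B :\ y) s / g B s).
  have -> : \sum_s mu s * (psi x s * psi y s / g B s) =
      \sum_s mu s * (g (B :\ x) s * g (B :\ y) s / g B s)
      - \sum_s mu s * g (B :\ x) s - \sum_s mu s * g (B :\ y) s + \sum_s mu s * g B s.
    rewrite -!sumrB -big_split; apply: eq_bigr => s _ /=; rewrite /psi; field.
    by rewrite gt_eqF.
  under [RHS]eq_bigr do rewrite mulrBr.
  by rewrite sumrB !g_mass; ring.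
apply: ler_sum => s _; rewrite ler_wpM2l ?(ltW (mu0 _)) //.
exact: mul_ln_ratio_ge.
Qed.

(* The inequality ln z >= 1 - 1/z bounds each second difference of the entropy by
   a covariance of one-site fluctuations psi; these are summed by spectral
   independence and compared with entropies by [bregman_quadratic], since the
   marginal bound gives g (B :\ x) <= g B / b. *)
Lemma block_entropy_pair :
  0 <= \sum_(x in B) \sum_(y in B :\ x) (h (B :\ x) + h (B :\ y) - h B - h (B :\ x :\ y))
    + 4 * eta / b * \sum_(x in B) (h B - h (B :\ x)).
Proof.
apply: le_trans (_ : 0 <= \sum_(x in B) \sum_(y in B :\ x)
    - (\sum_s mu s * (psi x s * psi y s / g B s))
    + 4 * eta / b * \sum_(x in B) \sum_s mu s * bregman (g (B :\ x) s) (g B s)) _; last first.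
  rewrite lerD //; last first.
    rewrite ler_wpM2l ?divr_ge0 ?mulr_ge0 ?(ltW b0) //; apply: ler_sum => x _.
    rewrite block_entropyB ?subD1set //.
    by apply: ler_sum => s _; rewrite mul1r.
  by apply: ler_sum => x _; apply: ler_sum => y _; exact: pair_term.
have -> : \sum_(x in B) \sum_(y in B :\ x) - (\sum_s mu s * (psi x s * psi y s / g B s)) =
    - \sum_s mu s * ((g B s)^-1 * (\sum_(x in B) \sum_(y in B :\ x) psi x s * psi y s)).
  under eq_bigr do rewrite sumrN.
  rewrite sumrN; congr (- _).
  under eq_bigr do rewrite exchange_big /=.
  rewrite exchange_big /=; apply: eq_bigr => s _.
  rewrite !mulr_sumr; apply: eq_bigr => x _; rewrite !mulr_sumr; apply: eq_bigr => y _.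
  by rewrite [psi x s * _ / _]mulrC.
have ginv : off_invariant B (fun s => (g B s)^-1).
  by move=> s r; rewrite /g cavg_invariant.
rewrite -(cavg_adjoint mu0 _ ginv) addrC subr_ge0.
apply: le_trans (_ : \sum_s mu s * ((g B s)^-1 *
    (eta * cavg mu B (fun r => \sum_(x in B) psi x r ^+ 2) s)) <= _).
  apply: ler_sum => s _; rewrite ler_wpM2l ?(ltW (mu0 _)) // ler_wpM2l //.
  by rewrite invr_ge0 ltW.
have -> : \sum_s mu s * ((g B s)^-1 * (eta * cavg mu B (fun r => \sum_(x in B) psi x r ^+ 2) s)) =
   eta * \sum_s mu s * ((g B s)^-1 * \sum_(x in B) psi x s ^+ 2).
  by rewrite -(cavg_adjoint mu0 (fun r => \sum_(x in B) psi x r ^+ 2) ginv) mulr_sumr; apply: eq_bigr => s _; ring.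
have -> : 4 * eta / b * (\sum_(x in B) \sum_s mu s * bregman (g (B :\ x) s) (g B s)) =
   eta * \sum_s mu s * \sum_(x in B) 4 / b * bregman (g (B :\ x) s) (g B s).
  rewrite exchange_big /= !mulr_sumr; apply: eq_bigr => s _.
  rewrite !mulr_sumr; apply: eq_bigr => x _; ring.
rewrite ler_wpM2l //; apply: ler_sum => s _; rewrite ler_wpM2l ?(ltW (mu0 _)) //.
rewrite mulr_sumr; apply: ler_sum => x xB; rewrite mulrC; exact: psi_sqr.
Qed.

End PairInequality.

(** * The Swendsen-Wang kernel *)

Section Kernel.
Variables (R : realType) (V : finType) (E : {set {set V}}) (q : nat) (beta : R).
Implicit Types (s r : {ffun V -> 'I_q}) (A M : {set {set V}}) (x y z u : V).
Hypothesis q0 : (0 < q)%N.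
Hypothesis beta0 : 0 < beta.
Hypothesis simpleE : simple_graph E.

Local Notation mu := (@gibbs R V E q beta).
Local Notation mono := (@mono_edges V E q).
Local Notation es := (@es_weight R V E q beta).
Local Notation cc := (@component_colouring R V q).
Local Notation perc := (@percolation R V beta).
Local Notation P := (@swendsen_wang R V E q beta).

Definition const_on_components A s : bool :=
  [forall x, forall y, connect (adj A) x y ==> (s x == s y)].

Lemma mono_sub s : mono s \subset E.
Proof. by apply/fintype.subsetP => e; rewrite inE => /andP[]. Qed.

Lemma sub_mono_const A s : A \subset E -> (A \subset mono s) = const_on_components A s.
Proof.
move=> AE; apply/idP/idP => [sA|cA].
  apply/forallP => x; apply/forallP => y; apply/implyP => /connectP[p pp ->].
  elim: p x pp => [|z p IH] x //= /andP[xz pp].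
  rewrite -(eqP (IH z pp)); have := fintype.subsetP sA _ xz.
  by rewrite inE => /andP[_ /forall_inP/(_ x)]; rewrite !inE eqxx => /(_ isT)/forall_inP; apply; rewrite !inE eqxx orbT.
apply/fintype.subsetP => e eA; have eE := fintype.subsetP AE _ eA.
rewrite inE eE; apply/forall_inP => x xe; apply/forall_inP => y ye.
have [->|xy] := eqVneq x y; first by rewrite eqxx.
have /forallP/(_ x)/forallP/(_ y)/implyP := cA; apply; apply: connect1.
by rewrite /adj -(edge_ends simpleE eE xe ye xy).
Qed.

(** A kept edge contributes e^beta (1 - e^-beta) = e^beta - 1 and a deleted one e^beta e^-beta =
    1. *)
Lemma percolation_weight A s : mu s * perc (mono s) A = es A s.
Proof.
rewrite /es_weight /percolation /gibbs mulrAC [RHS]mulrC; congr (_ / _).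
case: ifP => sA; last by rewrite mulr0.
have -> : weight E beta s = expR beta ^+ #|A| * expR beta ^+ #|mono s :\: A|.
  rewrite /weight expRM_natr -exprD -(cardsID A (mono s)); congr (_ ^+ (#|pred_of_set _| + _)).
  exact/setIidPr.
have x0 : expR beta != 0 by rewrite gt_eqF ?expR_gt0.
rewrite mulrACA -!exprMn expRN divff // expr1n mulr1; congr (_ ^+ _).
by rewrite mulrBr mulr1 divff.
Qed.

(** Such a colouring is determined by the spins of the component roots; a0 is a default off the
    roots, making this correspondence one-to-one. *)
Lemma card_const_on_components A :
  #|[set s : {ffun V -> 'I_q} | const_on_components A s]| = (q ^ n_comp (adj A) V)%N.
Proof.
have csym : connect_sym (adj A) := sym_connect_sym (@adj_sym V A).
pose a0 : 'I_q := Ordinal q0; pose rts := [pred x | roots (adj A) x].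
pose h (t : {ffun V -> 'I_q}) : {ffun V -> 'I_q} := [ffun x => t (fingraph.root (adj A) x)].
have -> : [set s | const_on_components A s] = h @: [set t | t \in pffun_on a0 rts predT].
  apply/setP => s; rewrite inE; apply/idP/imsetP => [cs|[t _ ->]].
    exists [ffun x => if x \in rts then s x else a0].
      by rewrite inE; apply/pffun_onP; split => //; apply/fintype.subsetP => x; rewrite inE ffunE; case: ifP => //; rewrite eqxx.
    apply/ffunP => x; rewrite !ffunE inE roots_root //.
    by have /forallP/(_ x)/forallP/(_ (fingraph.root (adj A) x))/implyP/(_ (connect_root _ _))/eqP := cs.
  apply/forallP => x; apply/forallP => y; apply/implyP => /(fingraph.rootP csym) e.
  by rewrite !ffunE e.
rewrite card_in_imset => [|t1 t2]; last first.
  rewrite !inE => /pffun_onP[s1 _] /pffun_onP[s2 _] e; apply/ffunP => x.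
  have [xr|xr] := boolP (x \in rts).
    by have := congr1 (fun k : {ffun _} => k x) e; rewrite !ffunE (eqP (xr : fingraph.root _ x == x)).
  have out t : {subset (a0.-support t) <= rts} -> t x = a0.
    by move=> st; apply/eqP; apply: contraNT xr => tx; apply: st.
  by rewrite !out //; apply/fintype.subsetP.
rewrite cardsE card_pffun_on card_ord; congr (_ ^ _)%N.
by apply: eq_card => x; rewrite !inE andbT.
Qed.

Lemma component_colouring_ge0 A s : 0 <= cc A s.
Proof. by rewrite /component_colouring; case: ifP => // _; rewrite invr_ge0 exprn_ge0. Qed.

Lemma component_colouring_sum A : \sum_s cc A s = 1.
Proof.
rewrite /component_colouring -big_mkcond /= sumr_const.
have -> : #|[pred s : {ffun V -> 'I_q} | const_on_components A s]| = (q ^ n_comp (adj A) V)%N.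
  by rewrite -card_const_on_components cardsE.
by rewrite -[LHS]mulr_natl natrX divff // expf_neq0 // pnatr_eq0 -lt0n.
Qed.

Lemma percolation_ge0 M A : 0 <= perc M A.
Proof.
rewrite /percolation; case: ifP => // _; rewrite mulr_ge0 ?exprn_ge0 ?expR_ge0 //.
by rewrite subr_ge0 -expR0 ler_expR oppr_le0 ltW.
Qed.

Lemma percolation_sum M : \sum_A perc M A = 1.
Proof.
by rewrite /percolation -big_mkcond sum_subsets_expr subrK expr1n.
Qed.

Lemma percolation_sub_edges s A : ~~ (A \subset E) -> perc (mono s) A = 0.
Proof.
move=> nA; rewrite /percolation ifN //; apply: contra nA => sA.
exact: fintype.subset_trans sA (mono_sub s).
Qed.

Lemma es_weight_sub_edges s A : ~~ (A \subset E) -> es A s = 0.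
Proof. by move=> nA; rewrite -percolation_weight percolation_sub_edges ?mulr0. Qed.

(** Detailed balance given A: for A inside E, both factors are constants depending on A times the
    indicator of being constant on components. *)
Lemma es_component_swap A s r : es A s * cc A r = es A r * cc A s.
Proof.
have [AE|AE] := boolP (A \subset E); last by rewrite !es_weight_sub_edges ?mul0r.
rewrite /es_weight /component_colouring !sub_mono_const // -/(const_on_components A s).
by rewrite -/(const_on_components A r); do 2!case: ifP => _; rewrite ?mulr0 ?mul0r.
Qed.

Lemma swendsen_wang_reversible s r : mu s * P s r = mu r * P r s.
Proof.
rewrite /swendsen_wang !mulr_sumr; apply: eq_bigr => A _.
by rewrite !mulrA !percolation_weight es_component_swap.
Qed.

Lemma swendsen_wang_sum1 s : \sum_r P s r = 1.
Proof.
rewrite /swendsen_wang exchange_big /= -(percolation_sum (mono s)).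
by apply: eq_bigr => A _; rewrite -mulr_sumr component_colouring_sum mulr1.
Qed.

(** The empty edge set survives percolation with positive probability and leaves all spins
    independent and uniform. *)
Lemma swendsen_wang_gt0 s r : 0 < P s r.
Proof.
rewrite /swendsen_wang (bigD1 finset.set0) //= ltr_wpDr //.
  by rewrite sumr_ge0 // => A _; rewrite mulr_ge0 ?percolation_ge0 ?component_colouring_ge0.
rewrite /percolation finset.sub0set cards0 expr0 mul1r mulr_gt0 ?exprn_gt0 ?expR_gt0 //.
rewrite /component_colouring ifT ?invr_gt0 ?exprn_gt0 ?ltr0n //.
apply/forallP => x; apply/forallP => y; apply/implyP => /connectP[p pp ->].
by case: p pp => [|z p] //=; rewrite /adj inE.
Qed.

Variable f : {ffun V -> 'I_q} -> R.
Hypothesis f0 : forall s, 0 < f s.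

Definition kernel_apply s : R := \sum_r P s r * f r.

Lemma kernel_apply_gt0 s : 0 < kernel_apply s.
Proof.
rewrite /kernel_apply (bigD1 s) //= ltr_wpDr ?sumr_ge0 // => [r _|].
  by rewrite mulr_ge0 ?(ltW (f0 _)) ?(ltW (swendsen_wang_gt0 _ _)).
by rewrite mulr_gt0 ?swendsen_wang_gt0.
Qed.

Let fA A : R := \sum_r cc A r * f r.

Let fA_gt0 A : 0 < fA A.
Proof. by apply: wsum_gt0 => // [r _|]; rewrite ?component_colouring_ge0 ?component_colouring_sum. Qed.

Let kernel_applyE s : kernel_apply s = \sum_A perc (mono s) A * fA A.
Proof.
rewrite /kernel_apply /swendsen_wang; under eq_bigr do rewrite mulr_suml.
rewrite exchange_big /=; apply: eq_bigr => A _; rewrite mulr_sumr.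
by apply: eq_bigr => r _; rewrite mulrA.
Qed.

Let es_mean A : \sum_s es A s * f s = \sum_s es A s * fA A.
Proof.
under [RHS]eq_bigr do rewrite mulr_sumr.
rewrite exchange_big /=; apply: eq_bigr => r _.
rewrite -[LHS]mulr1 -(component_colouring_sum A) mulr_sumr; apply: eq_bigr => s _.
by rewrite [RHS]mulrA es_component_swap; ring.
Qed.

(** Given A, recolouring all components replaces f by the constant fA A, a competitor in
    [bregman_cavg_min], so it loses at least as much entropy as resampling the isolated vertices.
    Forgetting A costs only Jensen's inequality for u ln u. *)
Lemma isolated_entropy_le_drop :
  isolated_entropy E beta f setT <=
  \sum_s mu s * (f s * ln (f s)) - \sum_s mu s * (kernel_apply s * ln (kernel_apply s)).
Proof.
apply: le_trans (_ : \sum_A \sum_s es A s * bregman (f s) (fA A) <= _).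
  apply: ler_sum => A _; rewrite setTI.
  have es0 s : 0 <= es A s by exact: es_weight_ge0.
  have inv : off_invariant (isolated A) (es A) by exact: es_weight_invariant.
  have z : block_entropy (es A) (fun=> 1) f finset.set0 = 0.
    rewrite /block_entropy big1 // => s _; rewrite cavg_set0 //.
    by rewrite subrr !mulr0.
  rewrite -[block_entropy _ _ _ _]subr0 -[X in _ - X]z block_entropyB ?finset.sub0set //.
  have tinv : off_invariant (isolated A) (fun _ : {ffun V -> 'I_q} => fA A) by [].
  have w0 (s : {ffun V -> 'I_q}) : 0 < (fun=> 1) s :> R by [].
  apply: le_trans (bregman_cavg_min es0 w0 f0 (finset.sub0set _) inv tinv (fun=> fA_gt0 A)) _.
  by apply: ler_sum => s _; rewrite cavg_set0 ?mulr1.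
have -> : \sum_A \sum_s es A s * bregman (f s) (fA A) =
    \sum_s mu s * (f s * ln (f s)) - \sum_s \sum_A es A s * (fA A * ln (fA A)).
  rewrite [X in _ - X]exchange_big /=.
  under [X in X - _]eq_bigr do rewrite -(sum_es_weight E beta) mulr_suml.
  rewrite [X in X - _]exchange_big /= -sumrB; apply: eq_bigr => A _.
  transitivity (\sum_s es A s * (f s * ln (f s)) - ln (fA A) * (\sum_s es A s * f s)
     - \sum_s es A s * f s + \sum_s es A s * fA A).
    rewrite mulr_sumr -!sumrB -big_split; apply: eq_bigr => s _ /=; rewrite /bregman; ring.
  rewrite es_mean mulr_sumr subrK; congr (_ - _).
  by apply: eq_bigr => s _; ring.
rewrite lerB //; apply: ler_sum => s _.
under [leRHS]eq_bigr do rewrite -percolation_weight -mulrA.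
rewrite -mulr_sumr ler_wpM2l ?(ltW (gibbs_gt0 _ _ _ _)) //.
set t := kernel_apply s; have t0 : 0 < t by exact: kernel_apply_gt0.
have : 0 <= \sum_A perc (mono s) A * bregman (fA A) t.
  by rewrite sumr_ge0 // => A _; rewrite mulr_ge0 ?percolation_ge0 ?bregman_ge0.
have -> : \sum_A perc (mono s) A * bregman (fA A) t =
  \sum_A perc (mono s) A * (fA A * ln (fA A)) - ln t * \sum_A perc (mono s) A * fA A
   - \sum_A perc (mono s) A * fA A + t * \sum_A perc (mono s) A.
  rewrite !mulr_sumr -!sumrB -big_split; apply: eq_bigr => A _ /=; rewrite /bregman; ring.
rewrite percolation_sum -kernel_applyE -/t mulr1 subrK mulrC subr_ge0.
by [].
Qed.

End Kernel.

(** * Entropy contraction *)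

Lemma half_le_sub1 (R : realFieldType) (t : R) : t <= 2^-1 -> 2^-1 <= 1 - t.
Proof. by move=> h; lra. Qed.

Section Contraction.
Variables (R : realType) (V : finType) (E : {set {set V}}) (q : nat) (beta b eta : R).
Implicit Types (s r : {ffun V -> 'I_q}) (B D : {set V}) (x y : V).
Hypothesis q2 : (2 <= q)%N.
Hypothesis beta0 : 0 < beta.
Hypothesis simpleE : simple_graph E.
Hypothesis spectral : spectrally_independent E q beta eta.
Hypothesis marginal : marginally_bounded E q beta b.
Variable x0 : V.

Local Notation mu := (@gibbs R V E q beta).
Local Notation mono := (@mono_edges V E q).

Let q0 : (0 < q)%N. Proof. exact: ltnW. Qed.
Let mu0 s : 0 < mu s. Proof. exact: gibbs_gt0. Qed.
Let b0 : 0 < b. Proof. by case: marginal. Qed.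

Lemma marginal_cavg B s x a : x \in B -> b <= cavg mu B (fun r => (r x == a)%:R) s.
Proof.
move=> xB; rewrite -(pinned_prob E beta q0 B s (spin_at x a)).
by case: marginal => _; apply; rewrite ffunE xB.
Qed.

Lemma influence_eigenvalue_le (tau : pinning V q) l :
  eigenvalue (influence_mx E beta tau) l -> l <= eta.
Proof.
move=> el; rewrite -lee_fin; apply: le_trans (spectral tau).
by apply: ereal_sup_ubound; exists l.
Qed.

Let s0 : {ffun V -> 'I_q} := [ffun=> Ordinal q0].

(* With a single free vertex the influence matrix is zero. *)
Lemma spectral_bound_ge0 : 0 <= eta.
Proof.
apply: (@influence_eigenvalue_le (pin [set x0] s0)).
have -> : influence_mx E beta (pin [set x0] s0) = 0.
  apply/matrixP => i j; rewrite !mxE; case: (enum_val i) (enum_val j) => [x a] [y a'] /=.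
  have one (z : free_vertex (pin [set x0] s0)) : val z = x0.
    by have := valP z; rewrite ffunE inE; case: ifP => // /eqP.
  by rewrite ifT //; apply/eqP/val_inj; rewrite !one.
have fx : pin [set x0] s0 x0 == None by rewrite ffunE inE eqxx.
pose t : free_vertex (pin [set x0] s0) * 'I_q := (exist _ x0 fx, Ordinal q0).
apply/eigenvalueP; exists (const_mx 1); first by rewrite mulmx0 scale0r.
apply/eqP => /rowP/(_ (enum_rank t)); rewrite !mxE => /eqP.
by rewrite oner_eq0.
Qed.

Lemma marginal_spins : b * q%:R <= 1.
Proof.
have s1 : \sum_a cavg mu [set x0] (fun r => (r x0 == a)%:R) s0 = 1.
  have -> : \sum_a cavg mu [set x0] (fun r => (r x0 == a)%:R) s0 =
     cavg mu [set x0] (fun r => \sum_a 1 * (r x0 == a)%:R) s0.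
    by rewrite (cavg_sum mu (fun=> 1) (fun a r => (r x0 == a)%:R)); apply: eq_bigr => a _; rewrite mul1r.
  have -> : cavg mu [set x0] (fun r => \sum_a 1 * (r x0 == a)%:R) s0 =
     resum [set x0] mu s0 / resum [set x0] mu s0.
    congr (_ / _); apply: eq_bigr => r _.
    rewrite (bigD1 (patch [set x0] s0 r x0)) //= eqxx mul1r big1 ?addr0 ?mulr1 // => a.
    by rewrite eq_sym => /negbTE ->; rewrite mulr0.
  by rewrite divff // gt_eqF // resum_gt0.
rewrite -[leRHS]s1; apply: le_trans (_ : \sum_(a < q) b <= _).
  by rewrite sumr_const card_ord mulr_natr.
by apply: ler_sum => a _; apply: marginal_cavg; rewrite inE.
Qed.

Lemma marginal_le_half : b <= 2^-1.
Proof.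
have := marginal_spins; have : (2 : R) <= q%:R by rewrite ler_nat.
have := b0; move: (q%:R : R) => u; nra.
Qed.

(** Given the spins off x, the spin r x has probability at least b, and s is just one of the
    configurations with those spins. *)
Lemma gibbs_update x s r : b * mu s <= mu (patch [set x] s r).
Proof.
pose g t : R := (t == patch [set x] s t)%:R.
have ginv : off_invariant [set x] g.
  move=> t t'; rewrite /g; congr (_%:R); congr nat_of_bool.
  apply/eqP/eqP => [h|->]; apply/ffunP => z; rewrite !ffunE; last by case: (z \in [set x]).
  by have := congr1 (fun k : {ffun _} => k z) h; rewrite !ffunE; case: (z \in [set x]).
have gs : g s = 1.
  by rewrite /g (_ : patch _ s s = s) ?eqxx //; apply/ffunP => z; rewrite ffunE if_same.
pose t' := patch [set x] s r; pose I t : R := (t x == r x)%:R.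
have key : cavg mu [set x] I s * \sum_t mu t * g t = mu t'.
  transitivity (\sum_t mu t * (g t * cavg mu [set x] I t)).
    rewrite mulr_sumr; apply: eq_bigr => t _; rewrite /g; case: eqP => [->|_].
      by rewrite cavg_invariant mul1r mulr1 mulrC.
    by rewrite mul0r !mulr0.
  rewrite (cavg_adjoint mu0 I ginv) (bigD1 t') //= big1 ?addr0 => [|t tt'].
    have et : patch [set x] s t' = t' by apply/ffunP => z; rewrite !ffunE; case: (z \in _).
    have ex : t' x = r x by rewrite ffunE inE eqxx.
    by rewrite /g /I et ex !eqxx !mulr1.
  rewrite /g /I; case: eqP => [e|_]; last by rewrite mul0r mulr0.
  case: eqP => [tx|_]; last by rewrite !mulr0.
  case/eqP: tt'; rewrite e; apply/ffunP => z; rewrite !ffunE inE.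
  by case: eqP => // ->.
rewrite -/t' -key; apply: ler_pM; rewrite ?(ltW b0) ?(ltW (mu0 _)) //.
  by apply: marginal_cavg; rewrite inE.
rewrite (bigD1 s) //= gs mulr1 lerDl sumr_ge0 // => t _.
by rewrite mulr_ge0 // ltW.
Qed.

Lemma gibbs_patch s r D : b ^+ #|D| * mu s <= mu (patch D s r).
Proof.
have b_ge0 := ltW b0.
move en : #|D| => n; elim: n D en => [|n IH] D cD.
  by rewrite (cards0_eq cD) patch_set0 expr0 mul1r.
have [x xD] : exists x, x \in D by apply/card_gt0P; rewrite cD.
have cDx : #|D :\ x| = n by move: cD; rewrite (cardsD1 x) xD => -[].
have -> : patch D s r = patch [set x] (patch (D :\ x) s r) r.
  by apply/ffunP => z; rewrite !ffunE !inE; case: eqP => [->|] //; rewrite xD.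
apply: le_trans (gibbs_update x _ r); rewrite exprS -mulrA ler_wpM2l //.
exact: IH.
Qed.

(** One factor b^n comes from changing all the spins, with n = #|V|; the other pays for the q^n
    configurations, since b q <= 1. *)
Lemma gibbs_ge s : b ^+ (2 * #|V|) <= mu s.
Proof.
have b_ge0 := ltW b0; have bn0 : 0 <= b ^+ #|V| by rewrite exprn_ge0.
rewrite mul2n -addnn exprD.
have h : b ^+ #|V| <= q%:R ^+ #|V| * mu s.
  rewrite -[leLHS]mulr1 -[X in _ * X <= _](gibbs_sum1 E beta q0) mulr_sumr.
  apply: le_trans (_ : \sum_(r : {ffun V -> 'I_q}) mu s <= _).
    by apply: ler_sum => r _; have := gibbs_patch r s setT; rewrite cardsT patch_setT.
  by rewrite sumr_const card_ffun card_ord -[leLHS]mulr_natl natrX.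
apply: le_trans (ler_wpM2l bn0 h) _; rewrite mulrA -exprMn ler_piMl ?(ltW (mu0 _)) //.
by rewrite exprn_ile1 ?marginal_spins // mulr_ge0.
Qed.

(** Recolouring x in a constant configuration destroys exactly the edges at x, while mu drops by a
    factor of at least b. A second spin exists because q >= 2. *)
Lemma expR_degree_le x : expR (beta * #|[set e in E | x \in e]|%:R) <= b^-1.
Proof.
set d := #|_|; pose s1 : {ffun V -> 'I_q} := patch [set x] s0 [ffun=> Ordinal q2].
have := gibbs_update x s0 [ffun=> Ordinal q2]; rewrite -/s1.
rewrite /gibbs mulrA ler_pM2r ?invr_gt0 ?(partition_fun_gt0 E beta q0) // /weight.
have -> : mono s0 = E.
  apply/setP => e; rewrite inE; case: (e \in E) => //=.
  by apply/forall_inP => y _; apply/forall_inP => z _; rewrite !ffunE.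
have cE : #|E| = (d + #|mono s1|)%N.
  rewrite -(cardsID [set e in E | x \in e] E).
  have -> : E :&: [set e in E | x \in e] = [set e in E | x \in e].
    by apply/setIidPr/fintype.subsetP => e; rewrite inE => /andP[].
  congr (_ + _)%N; apply: eq_card => e; rewrite !inE; case: (boolP (e \in E)) => eE; rewrite ?andbF //= andbT.
  have [xe|xe] := boolP (x \in e).
    have [y yx ye] : exists2 y, y != x & y \in e.
      have : (0 < #|e :\ x|)%N by have := simpleE eE; rewrite (cardsD1 x) xe add1n => -[->].
      by case/card_gt0P => y; rewrite !inE => /andP[yx ye]; exists y.
    apply/esym/negbTE/negP => /forall_inP/(_ _ xe)/forall_inP/(_ _ ye).
    by rewrite !ffunE !inE eqxx (negbTE yx).
  apply/esym/forall_inP => y ye; apply/forall_inP => z ze.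
  have ne w : w \in e -> (w == x) = false by move=> we; apply: contraNF xe => /eqP <-.
  by rewrite !ffunE !inE !ne.
rewrite cE natrD mulrDr expRD mulrA -[leRHS]mul1r ler_pM2r ?expR_gt0 // mulrC.
by rewrite -ler_pdivlMr // mul1r.
Qed.

Variable f : {ffun V -> 'I_q} -> R.
Hypothesis f0 : forall s, 0 < f s.

Lemma gibbs_entropy_setT :
  gibbs_entropy E beta f setT = \sum_s mu s * (f s * ln (f s / expect mu f)).
Proof.
have E0 : 0 < expect mu f.
  by apply: wsum_gt0 => // [s _|]; rewrite ?(ltW (mu0 _)) // gibbs_sum1.
apply: eq_bigr => s _; rewrite mul1r ln_div ?posrE //; congr (_ * (_ * (_ - ln _))).
rewrite /cavg /resum; under eq_bigr do rewrite patch_setT.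
by under [X in _ / X]eq_bigr do rewrite patch_setT; rewrite gibbs_sum1 // divr1.
Qed.

Theorem entropy_drop (a : nat) : 4 * eta / b + 1 <= a%:R ->
  (b / 2 ^+ (max_degree E).+2) ^+ a * entropy mu f <=
  b^-1 * 2 ^+ (max_degree E).+1 *
    (\sum_s mu s * (f s * ln (f s)) -
     \sum_s mu s * (kernel_apply E beta f s * ln (kernel_apply E beta f s))).
Proof.
move=> ha; set D := max_degree E.
have b_half := marginal_le_half.
have b1 : b <= 1 by apply: le_trans b_half _; rewrite invf_le1 ?ler1n.
have eta0 := spectral_bound_ge0.
have a0 : (0 < a)%N.
  rewrite -(ltr_nat R); apply: lt_le_trans ha; rewrite ltr_wpDl //.
  by rewrite divr_ge0 ?mulr_ge0 ?(ltW b0).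
have p0 n : 0 < 2 ^+ n :> R by rewrite exprn_gt0.
(* With c = 1/b the threshold concerns theta / (b (1 - theta)), and theta / b = 2^-(D+2); the spare
   factor 2 covers 1 - theta >= 1/2. *)
pose theta := b / 2 ^+ D.+2.
have t0 : 0 < theta by rewrite divr_gt0.
have p2 : (2 : R) <= 2 ^+ D.+2 by rewrite ler_eXnr // ler1n.
have th : theta <= 2^-1.
  rewrite ler_pdivrMr //; apply: le_trans b_half _; rewrite ler_peMr //.
  by apply: le_trans p2; rewrite ler1n.
have t01 : 0 < theta < 1 by rewrite t0 (le_lt_trans th) // invf_lt1 ?ltr1n.
have t01' : 0 <= theta <= 1 by case/andP: t01 => /ltW -> /ltW ->.
rewrite (_ : entropy mu f = gibbs_entropy E beta f setT); last by rewrite gibbs_entropy_setT.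
have BF := bernoulli_block_factorization (gibbs_entropy0 E beta q0 f)
  (gibbs_entropy_mono E beta q0 f0) _ ha a0 t01'.
apply: le_trans (BF _) _ => {BF}.
  move=> B; apply: (block_entropy_pair mu0 f0 eta0 b0 b1).
    by move=> s x c xB; exact: marginal_cavg.
  move=> s phi; apply: influence_quadratic_form => //.
    by move=> x c xB; apply: lt_le_trans b0 _; exact: marginal_cavg.
  exact: influence_eigenvalue_le.
have cdeg : expR (beta * D%:R) <= b^-1.
  have [x ->] : exists x, D = #|[set e in E | x \in e]|.
    have V0 : (0 < #|V|)%N by apply/card_gt0P; exists x0.
    by have [x ex] := @bigop.eq_bigmax V (fun x => #|[set e in E | x \in e]|) V0; exists x.
  exact: expR_degree_le.
have small : b^-1 * (theta / (1 - theta)) <= (2 ^+ D.+1)^-1.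
  rewrite mulrA ler_pdivrMr; last by case/andP: t01 => _; rewrite subr_gt0.
  rewrite /theta mulKf ?gt_eqF // -/theta [2 ^+ D.+2]exprS invfM [leRHS]mulrC.
  by rewrite ler_pM2r ?invr_gt0 // half_le_sub1.
have comb := bernoulli_cluster_comparison (adj_sym E) (adj_degree simpleE)
  (gibbs_entropy0 E beta q0 f) (isolated_entropy0 E beta f)
  (gibbs_entropy_mono E beta q0 f0) (isolated_entropy_mono E q0 beta0 f0) _ _ _ t01 small.
apply: le_trans (comb _ _ _) _.
- by move=> A B y AB; exact: isolated_entropy_submod.
- by rewrite invr_ge0 ltW.
- by move=> U Z dUZ nadj; exact: block_comparison.
rewrite ler_wpM2l ?mulr_ge0 ?invr_ge0 ?(ltW b0) ?(ltW (p0 _)) //.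
apply: le_trans (isolated_entropy_le_drop q0 beta0 simpleE f0).
apply: le_trans (_ : \sum_(B : {set V}) bernoulli_wt theta B * isolated_entropy E beta f setT <= _).
  apply: ler_sum => B _; rewrite ler_wpM2l ?bernoulli_wt_ge0 //.
  by apply: isolated_entropy_mono => //; exact: finset.subsetT.
rewrite -mulr_suml.
have -> : \sum_(B : {set V}) bernoulli_wt theta B = 1.
  have := bernoulli_wt_superset theta (finset.set0 : {set V}); rewrite cards0 expr0 => <-.
  by apply: eq_bigl => B; rewrite finset.sub0set.
by rewrite mul1r.
Qed.

End Contraction.

(** * Reversible chains contracting entropy *)

Section ReversibleChain.
Variables (R : realType) (T : finType) (mu : T -> R) (P : T -> T -> R) (rho : R).
Hypothesis mu0 : forall x, 0 < mu x.
Hypothesis mu1 : \sum_x mu x = 1.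
Hypothesis P0 : forall x y, 0 < P x y.
Hypothesis P1 : forall x, \sum_y P x y = 1.
Hypothesis reversible : forall x y, mu x * P x y = mu y * P y x.

Let apply f x : R := \sum_y P x y * f y.

Hypothesis contraction : forall f, (forall x, 0 < f x) ->
  rho * entropy mu f <=
  \sum_x mu x * (f x * ln (f x)) - \sum_x mu x * (apply f x * ln (apply f x)).

Let apply_gt0 f x : (forall y, 0 < f y) -> 0 < apply f x.
Proof.
move=> f0; apply: wsum_gt0 => // [y _|]; first exact: ltW.
by rewrite P1.
Qed.

Let apply_adjoint f g : \sum_x mu x * (g x * apply f x) = \sum_x mu x * (f x * apply g x).
Proof.
transitivity (\sum_x \sum_y mu x * P x y * (g x * f y)).
  by apply: eq_bigr => x _; rewrite /apply !mulr_sumr; apply: eq_bigr => y _; ring.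
rewrite exchange_big /=; apply: eq_bigr => y _; rewrite /apply !mulr_sumr.
by apply: eq_bigr => x _; rewrite reversible; ring.
Qed.

Let apply_mean f : \sum_x mu x * apply f x = \sum_x mu x * f x.
Proof.
have := apply_adjoint f (fun=> 1); under eq_bigr do rewrite mul1r.
by move=> ->; apply: eq_bigr => x _; rewrite /apply; under eq_bigr do rewrite mulr1; rewrite P1 mulr1.
Qed.

(* If f vanishes at some points but not everywhere, positivity of P makes the
   Dirichlet form infinite. *)
Lemma mls_of_contraction : mls_inequality P mu rho.
Proof.
move=> f f0; have [fpos|/existsNP[x0 /negP]] := pselect (forall x, 0 < f x).
  rewrite /dirichlet_log.
  have -> : (\sum_(x : T) (mu x * f x)%:E * (lne (f x)%:E - \sum_(y : T) (P x y)%:E * lne (f y)%:E)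
     = (\sum_x mu x * f x * (ln (f x) - \sum_y P x y * ln (f y)))%:E)%E.
    rewrite -sumEFin; apply: eq_bigr => x _; rewrite lne_EFin //.
    rewrite (eq_bigr (fun y => (P x y * ln (f y))%:E)) ?sumEFin // => y _.
    by rewrite lne_EFin.
  rewrite lee_fin; apply: le_trans (contraction fpos) _.
  have -> : \sum_x mu x * f x * (ln (f x) - \sum_y P x y * ln (f y)) =
     \sum_x mu x * (f x * ln (f x)) - \sum_x mu x * (f x * apply (fun y => ln (f y)) x).
    by rewrite -sumrB; apply: eq_bigr => x _; rewrite /apply; ring.
  (* By reversibility the logarithm falls on f and the kernel on the other factor. As f and its
     image have equal mass, Gibbs' inequality applies. *)
  rewrite lerB // -apply_adjoint -subr_ge0.
  have : 0 <= \sum_x mu x * bregman (apply f x) (f x).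
    by rewrite sumr_ge0 // => x _; rewrite mulr_ge0 ?(ltW (mu0 _)) ?bregman_ge0 ?apply_gt0.
  have -> : \sum_x mu x * bregman (apply f x) (f x) =
      \sum_x mu x * (apply f x * ln (apply f x)) - \sum_x mu x * (ln (f x) * apply f x)
       - \sum_x mu x * apply f x + \sum_x mu x * f x.
    by rewrite -!sumrB -big_split; apply: eq_bigr => x _ /=; rewrite /bregman; ring.
  by rewrite apply_mean subrK.
rewrite -leNgt => fx0; have {}fx0 : f x0 = 0 by apply/le_anti; rewrite fx0 f0.
have [allz|/existsNP[x1 /eqP fx1]] := pselect (forall x, f x = 0).
  have -> : entropy mu f = 0.
    by rewrite /entropy big1 // => x _; rewrite allz mul0r mulr0.
  rewrite mulr0 /dirichlet_log big1 // => x _.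
  by rewrite allz mulr0 mul0e.
suff -> : dirichlet_log P mu f = +oo%E by rewrite leey.
have term x : f x != 0 ->
    ((mu x * f x)%:E * (lne (f x)%:E - \sum_(y : T) (P x y)%:E * lne (f y)%:E) = +oo)%E.
  move=> fx; have fxp : 0 < f x by rewrite lt_def fx f0.
  have -> : (\sum_(y : T) (P x y)%:E * lne (f y)%:E = -oo)%E.
    apply/eqP; rewrite esum_eqNy; apply/existsP; exists x0.
    by rewrite /= fx0 lexx gt0_muleNy // lte_fin.
  by rewrite lne_EFin //= gt0_muley // lte_fin mulr_gt0.
apply/eqP; rewrite /dirichlet_log esum_eqy.
  by apply/existsP; exists x1; rewrite /= term.
move=> x _; have [->|fx] := eqVneq (f x) 0; last by rewrite term.
by rewrite mulr0 mul0e.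
Qed.

Lemma mls_constant_ge : (rho%:E <= mls_constant P mu)%E.
Proof. by apply: ereal_sup_ubound; exists rho => //; exact: mls_of_contraction. Qed.

Lemma kernel_iterSr t x y :
  kernel_iter P t.+1 x y = \sum_z kernel_iter P t x z * P z y.
Proof.
elim: t x => [|t IH] x.
  rewrite /= (bigD1 y) //= eqxx mulr1 big1 ?addr0 => [|z /negbTE ->]; last by rewrite mulr0.
  rewrite (bigD1 x) //= eqxx mul1r big1 ?addr0 // => z.
  by rewrite eq_sym => /negbTE ->; rewrite mul0r.
transitivity (\sum_z P x z * kernel_iter P t.+1 z y); first by [].
under eq_bigr do rewrite IH mulr_sumr.
rewrite exchange_big /=; apply: eq_bigr => z _; rewrite mulr_suml.
by apply: eq_bigr => u _; rewrite mulrA.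
Qed.

Lemma kernel_iter_reversible t x y :
  mu x * kernel_iter P t x y = mu y * kernel_iter P t y x.
Proof.
elim: t x y => [|t IH] x y.
  by rewrite /= eq_sym; case: eqP => [->|]; rewrite ?mulr0.
rewrite kernel_iterSr /= !mulr_sumr; apply: eq_bigr => z _.
by rewrite mulrA IH mulrAC reversible mulrA.
Qed.

(** By reversibility this is the density relative to mu of the law at time t started from x; with
    the arguments swapped, one step of the chain is [apply]. *)
Let density x t y : R := kernel_iter P t y x / mu x.

Let densityS x t y : density x t.+1 y = apply (density x t) y.
Proof. by rewrite /density /apply /= mulr_suml; apply: eq_bigr => z _; rewrite mulrA. Qed.

Let density_mean x t : \sum_y mu y * density x t y = 1.
Proof.
elim: t => [|t IH].
  rewrite (bigD1 x) //= /density /= eqxx big1 ?addr0 => [|y /negbTE ->]; last by rewrite mul0r mulr0.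
  by rewrite mul1r divff // gt_eqF.
by rewrite -[RHS]IH -[RHS]apply_mean; apply: eq_bigr => y _; rewrite densityS.
Qed.

(** Time 0 is excluded: the initial density vanishes off x, while [contraction] is about positive
    functions. The decay of entropy thus starts at time 1. *)
Let density_gt0 x t y : 0 < density x t.+1 y.
Proof.
rewrite divr_gt0 //; elim: t y => [|t IH] y.
  by rewrite /= (bigD1 x) //= eqxx mulr1 big1 ?addr0 // => z /negbTE ->; rewrite mulr0.
change (0 < \sum_z P y z * kernel_iter P t.+1 z x).
by apply: wsum_gt0 => // [z _|]; [exact: ltW | rewrite P1].
Qed.

Let ent x t : R := \sum_y mu y * (density x t y * ln (density x t y)).

Let entE x t : entropy mu (density x t) = ent x t.
Proof.
rewrite /entropy /ent (_ : expect mu _ = 1); last exact: density_mean.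
by apply: eq_bigr => y _; rewrite divr1.
Qed.

Let ent_bregman x t : ent x t = \sum_y mu y * bregman (density x t y) 1.
Proof.
transitivity (ent x t - \sum_y mu y * density x t y + \sum_y mu y).
  by rewrite density_mean mu1 subrK.
rewrite -sumrB -big_split; apply: eq_bigr => y _ /=; rewrite /bregman ln1; ring.
Qed.

Let entS x t : ent x t.+2 <= (1 - rho) * ent x t.+1.
Proof.
have := contraction (density_gt0 x t); rewrite entE -/(ent x t.+1).
have -> : \sum_y mu y * (apply (density x t.+1) y * ln (apply (density x t.+1) y)) = ent x t.+2.
  by apply: eq_bigr => y _; rewrite -densityS.
by lra.
Qed.

Variable m : R.
Hypothesis m0 : 0 < m.
Hypothesis m_le : forall x, m <= mu x.

Let ent1 x : ent x 1 <= ln m^-1.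
Proof.
have P_le1 y z : P y z <= 1.
  by rewrite -(P1 y) (bigD1 z) //= lerDl sumr_ge0 // => w _; exact: ltW.
have le1 y : density x 1 y <= m^-1.
  rewrite /density /= (bigD1 x) //= eqxx mulr1 big1 ?addr0 => [|z /negbTE ->]; last by rewrite mulr0.
  by rewrite -[leRHS]mul1r ler_pM ?invr_ge0 ?(ltW (P0 _ _)) ?(ltW (mu0 _)) // lef_pV2 ?posrE.
rewrite -[leRHS]mul1r -[X in X * _](density_mean x 1) mulr_suml; apply: ler_sum => y _.
rewrite -mulrA ler_wpM2l ?(ltW (mu0 _)) // ler_wpM2l ?(ltW (density_gt0 _ _ _)) //.
by rewrite ler_ln ?posrE ?density_gt0 ?invr_gt0.
Qed.

Let ent_ge0 x t : 0 <= ent x t.+1.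
Proof.
rewrite ent_bregman sumr_ge0 // => y _.
by rewrite mulr_ge0 ?(ltW (mu0 _)) // bregman_ge0.
Qed.

Let ent_decay x k : ent x k.+1 <= expR (- rho * k%:R) * ln m^-1.
Proof.
elim: k => [|k IH]; first by rewrite mulr0 expR0 mul1r.
apply: le_trans (entS x k) _; apply: le_trans (_ : expR (- rho) * ent x k.+1 <= _).
  by rewrite ler_wpM2r // expR_ge1Dx.
by rewrite -natr1 mulrDr mulr1 expRD [X in _ <= X * _]mulrC -mulrA ler_wpM2l ?expR_ge0.
Qed.

(** Averaging [abs_sub1_le_bregman] bounds the l1 distance by 4 times the entropy plus 1/4. Entropy
    1/16 makes this 1/2, which is total variation 1/4. *)
Lemma tv_dist_decay x k : expR (- rho * k%:R) * ln m^-1 <= 16^-1 ->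
  tv_dist (kernel_iter P k.+1 x) mu <= 4^-1.
Proof.
move=> hk; have h : ent x k.+1 <= 16^-1 := le_trans (ent_decay x k) hk.
rewrite /tv_dist.
have : \sum_y `|kernel_iter P k.+1 x y - mu y| <= 4 * ent x k.+1 + 2 / 8.
  apply: le_trans (_ : \sum_y mu y * (4 * bregman (density x k.+1 y) 1 + (1 + density x k.+1 y) / 8) <= _).
    apply: ler_sum => y _.
    have -> : kernel_iter P k.+1 x y - mu y = mu y * (density x k.+1 y - 1).
      rewrite mulrBr mulr1 /density mulrA -kernel_iter_reversible mulrAC divff ?mul1r //.
      by rewrite gt_eqF.
    rewrite normrM (gtr0_norm (mu0 y)) ler_wpM2l ?(ltW (mu0 _)) //.
    exact: abs_sub1_le_bregman.
  rewrite le_eqVlt; apply/orP; left; apply/eqP.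
  transitivity (4 * ent x k.+1 + 8^-1 * (\sum_y mu y + \sum_y mu y * density x k.+1 y)).
    rewrite ent_bregman -big_split !mulr_sumr -big_split /=.
    by apply: eq_bigr => y _; ring.
  by rewrite mu1 density_mean; congr (_ + _); field.
move: (\sum_y _) (ent x k.+1) h => u v; lra.
Qed.

Lemma mixing_time_le (N : R) k : expR (- rho * k%:R) * ln m^-1 <= 16^-1 ->
  k.+1%:R <= N -> (mixing_time P mu <= N%:E)%E.
Proof.
move=> hk kN; apply: ub_ereal_sup => _ [x _ <-].
apply: le_trans (_ : (k.+1%:R%:E <= _)%E); last by rewrite lee_fin.
apply: ereal_inf_lbound; exists k.+1 => //=; exact: tv_dist_decay.
Qed.

End ReversibleChain.

(** * Explicit constants and final assembly *)

Section Constants.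
Variables (R : realType) (b eta : R) (Delta : nat).
Hypothesis b0 : 0 < b.
Hypothesis b_half : b <= 2^-1.
Hypothesis eta0 : 0 <= eta.
Hypothesis Delta1 : (1 <= Delta)%N.

Let u := 2 / b.

(** One successor undoes the rounding down, the other supplies the + 1 demanded of the growth
    exponent. *)
Definition drop_exponent : nat := (Num.truncn (4 * eta / b)).+2.

Definition drop_power : nat := Delta.+2 * drop_exponent + Delta.+1.

Let x0 : 0 <= 4 * eta / b. Proof. by rewrite divr_ge0 ?mulr_ge0 // ltW. Qed.

Lemma drop_exponent_ge : 4 * eta / b + 1 <= drop_exponent%:R.
Proof. by rewrite /drop_exponent -[leRHS]natr1 lerD2r ltW // truncnS_gt. Qed.

Lemma base_ge4 : 4 <= u.
Proof. by rewrite ler_pdivlMr //; move: b_half; lra. Qed.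

Let u1 : 1 <= u. Proof. by apply: le_trans base_ge4; rewrite ler1n. Qed.

Let u0 : 0 <= u. Proof. exact: le_trans u1. Qed.
Let u2 : 2 <= u. Proof. by apply: le_trans base_ge4; rewrite ler_nat. Qed.

Lemma base_pow_le (n : nat) : 2 ^+ n.+1 / b <= u ^+ n.+1.
Proof.
rewrite !exprS mulrAC -/u ler_wpM2l //.
by rewrite lerXn2r ?nnegrE.
Qed.

Lemma drop_factor_le :
  b^-1 * 2 ^+ Delta.+1 * (2 ^+ Delta.+2 / b) ^+ drop_exponent <= u ^+ drop_power.
Proof.
rewrite /drop_power addnC exprD exprM.
have p0 n : 0 <= 2 ^+ n / b by rewrite divr_ge0 ?exprn_ge0 // ltW.
apply: ler_pM; rewrite ?exprn_ge0 //; first by rewrite mulrC.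
  by rewrite mulrC base_pow_le.
by rewrite lerXn2r ?nnegrE ?base_pow_le // exprn_ge0.
Qed.

(** The 3 makes room for the u^3 of [mixing_steps]. With y = eta / b, the bounds a <= 4 y + 2 and
    Delta + 2 <= 3 Delta give at most 12 Delta y + 7 Delta + 4. *)
Lemma constant_exponent_le :
  (3 + drop_power)%:R <= 12 * (Delta%:R * (1 + eta / b)).
Proof.
rewrite /drop_power addnA !natrD natrM.
have D1 : 1 <= Delta%:R :> R by rewrite ler1n.
have a_le : drop_exponent%:R <= 4 * (eta / b) + 2 :> R.
  rewrite /drop_exponent -addn2 natrD lerD2r mulrA.
  by have /andP[] := truncn_itv x0.
have y0 : 0 <= eta / b by rewrite divr_ge0 // ltW.
rewrite -[Delta.+2]addn2 -[Delta.+1]addn1 !natrD.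
move: (Delta%:R : R) (drop_exponent%:R : R) (eta / b) D1 a_le y0 => D a y D1 ay y0.
have a0 : (D + 2) * a <= (3 * D) * (4 * y + 2).
  apply: le_trans (_ : (D + 2) * (4 * y + 2) <= _).
    by rewrite ler_wpM2l // addr_ge0 // (le_trans _ D1).
  by rewrite ler_wpM2r; lra.
have e1 : 3 * D * (4 * y + 2) = 12 * (D * y) + 6 * D by ring.
have e2 : D * (1 + y) = D + D * y by ring.
by rewrite e2; rewrite e1 in a0; move: (D * y) ((D + 2) * a) a0 => z w; lra.
Qed.

Lemma mixing_steps (n : nat) (C0 : R) : (2 <= n)%N -> 1 <= C0 ->
  exists2 k : nat, expR (- C0^-1 * k%:R) * ln (b ^+ (2 * n))^-1 <= 16^-1 &
    k.+1%:R <= u ^+ 3 * C0 * ln n%:R.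
Proof.
move=> n2 C1; have C00 : 0 < C0 := lt_le_trans ltr01 C1.
have n0 : 0 < n%:R :> R by rewrite ltr0n ltnW.
(* Chosen so that 2 n / b, a bound for the initial entropy, divided by X is exactly 1/16. *)
pose X : R := 32 * n%:R / b.
have X0 : 0 < X by rewrite divr_gt0 ?mulr_gt0.
have X1 : 1 <= X.
  rewrite ler_pdivlMr // mul1r; apply: le_trans b_half _.
  by have : 2 <= n%:R :> R by [rewrite ler_nat]; lra.
have lnX : 0 <= ln X by rewrite ln_ge0.
have y0 : 0 <= C0 * ln X by rewrite mulr_ge0 // ltW.
exists (Num.truncn (C0 * ln X)).+1.
  have kX : ln X <= C0^-1 * (Num.truncn (C0 * ln X)).+1%:R.
    by rewrite mulrC ler_pdivlMr // mulrC ltW // truncnS_gt.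
  have h1 : expR (- C0^-1 * (Num.truncn (C0 * ln X)).+1%:R) <= X^-1.
    have -> : X^-1 = expR (- ln X) by rewrite expRN lnK ?posrE.
    by rewrite ler_expR mulNr lerN2.
  have h2 : ln (b ^+ (2 * n))^-1 <= 2 * n%:R / b.
    have bV0 : 0 < b^-1 by rewrite invr_gt0.
    rewrite -exprVn lnXn // -[leLHS]mulr_natl natrM ler_wpM2l ?mulr_ge0 //.
    by apply: le_trans (ln_le_sub1 bV0) _; rewrite gerBl.
  have h3 : 0 <= ln (b ^+ (2 * n))^-1.
    rewrite ln_ge0 // invf_ge1 ?exprn_gt0 // exprn_ile1 ?(ltW b0) //.
    by apply: le_trans b_half _; rewrite invf_le1 ?ler1n.
  apply: le_trans (ler_pM (expR_ge0 _) h3 h1 h2) _.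
  rewrite le_eqVlt; apply/orP; left; apply/eqP; rewrite /X; field.
  by rewrite !gt_eqF.
(* From n >= 2; this lets additive constants be absorbed into ln n. *)
have lnn : 2^-1 <= ln n%:R :> R.
  apply: le_trans (_ : ln 2 <= _); last by rewrite ler_ln ?posrE // ler_nat.
  have h2 : 0 < 2^-1 :> R by rewrite invr_gt0.
  by have := ln_le_sub1 h2; rewrite lnV ?posrE //; move: (ln 2) => l; lra.
have lnXle : ln X <= 7 * u * ln n%:R.
  have -> : X = n%:R * (16 * u) by rewrite /X /u; field; rewrite gt_eqF.
  have up : 0 < u by rewrite divr_gt0.
  have u16 : 16 * u \is Num.pos by rewrite posrE mulr_gt0.
  rewrite lnM ?posrE //.
  have : ln (16 * u) <= 3 * u.
    have le16 : 16 * u <= u ^+ 3.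
      rewrite [u ^+ 3]exprSr ler_wpM2r // (_ : 16 = 4 ^+ 2); last by ring.
      by rewrite lerXn2r ?nnegrE // base_ge4.
    have p2 : u ^+ 3 \is Num.pos by rewrite posrE exprn_gt0.
    rewrite -(ler_ln u16 p2) in le16; apply: le_trans le16 _.
    rewrite lnXn // -[leLHS]mulr_natl ler_wpM2l //.
    by apply: le_trans (ln_le_sub1 up) _; rewrite gerBl.
  have : 3 * u <= 6 * (u * ln n%:R).
    have -> : 6 * (u * ln n%:R) = 3 * u * (2 * ln n%:R) by ring.
    have L1 : 1 <= 2 * ln n%:R :> R by rewrite -ler_pdivrMl // mulr1.
    by rewrite ler_peMr // mulr_ge0.
  have : ln n%:R <= u * ln n%:R by rewrite ler_peMl // (le_trans _ lnn) // invr_ge0.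
  rewrite -[7 * u * _]mulrA.
  by move: (u * ln n%:R) (ln n%:R) (ln (16 * u)) => w v p; lra.
have tr : (Num.truncn (C0 * ln X))%:R <= C0 * ln X by have /andP[] := truncn_itv y0.
have -> : (Num.truncn (C0 * ln X)).+2%:R = (Num.truncn (C0 * ln X))%:R + 2 :> R.
  by rewrite -addn2 natrD.
have uL : 4 * 2^-1 <= u * ln n%:R by rewrite ler_pM // base_ge4.
have step : C0 * ln X <= C0 * (7 * u * ln n%:R) by rewrite ler_pM2l.
have two : 2 <= C0 * (u * ln n%:R).
  rewrite -[leLHS]mul1r ler_pM //; move: uL; lra.
have -> : u ^+ 3 * C0 * ln n%:R = u ^+ 2 * (C0 * (u * ln n%:R)) by ring.
(* The 8 is 7 from ln X plus 1 from two extra steps, for rounding up and for starting at time 1; u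
   >= 4 gives u^2 >= 8. *)
apply: le_trans (_ : 8 * (C0 * (u * ln n%:R)) <= _); last first.
  rewrite ler_wpM2r ?(le_trans _ two) //.
  apply: le_trans (_ : 4 ^+ 2 <= _); first by rewrite -natrX ler_nat.
  by rewrite lerXn2r ?nnegrE // base_ge4.
apply: le_trans (_ : C0 * (7 * u * ln n%:R) + 2 <= _).
  by rewrite lerD2r; apply: le_trans tr _.
have -> : C0 * (7 * u * ln n%:R) = 7 * (C0 * (u * ln n%:R)) by ring.
by move: (C0 * (u * _)) two => w; lra.
Qed.

End Constants.

Theorem theorem1p8 (R : realType) :
  exists K : R, 0 < K /\
  exists C : R -> R -> nat -> R,
    (forall (b eta : R) (Delta : nat), 0 < b -> 0 <= eta -> (1 <= Delta)%N ->
       exists e : R, `|e| <= K * (Delta%:R * (1 + eta / b)) /\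
                     C b eta Delta = (2 / b) `^ e) /\
    (forall (q : nat) (beta : R) (V : finType) (E : {set {set V}})
            (Delta : nat) (b eta : R),
       (2 <= q)%N -> 0 < beta ->
       simple_graph E -> (2 <= #|V|)%N ->
       max_degree E = Delta -> (1 <= Delta)%N ->
       spectrally_independent E q beta eta ->
       marginally_bounded E q beta b ->
       (mixing_time (swendsen_wang E (q := q) beta) (gibbs E (q := q) beta)
          <= (C b eta Delta * ln #|V|%:R)%:E)%E /\
       (((C b eta Delta)^-1)%:E
          <= mls_constant (swendsen_wang E (q := q) beta)
                          (gibbs E (q := q) beta))%E).
Proof.
exists 12; split=> //.
exists (fun b eta Delta => (2 / b) `^ (12 * (Delta%:R * (1 + eta / b)))); split.
  move=> b eta Delta b0 eta0 _; exists (12 * (Delta%:R * (1 + eta / b))); split=> //.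
  by rewrite ger0_norm // !mulr_ge0 // addr_ge0 // divr_ge0 // ltW.
move=> q beta V E Delta b eta q2 beta0 simpleE V2 degE Delta1 spectral marginal.
have [x0 _] : exists x0 : V, x0 \in V by apply/card_gt0P; exact: ltnW.
have b0 : 0 < b by case: marginal.
have q0 : (0 < q)%N by exact: ltnW.
have b_half : b <= 2^-1 := marginal_le_half q2 marginal x0.
have eta0 : 0 <= eta := spectral_bound_ge0 q2 spectral x0.
set u := 2 / b; have u1 : 1 <= u by apply: le_trans (base_ge4 b0 b_half); rewrite ler1n.
have u0 : 0 < u := lt_le_trans ltr01 u1.
set N := drop_power b eta Delta.
(* C0 is the inverse contraction rate; the gap u^3 between C0 and C pays for the constants in the
   number of steps. *)
pose C0 : R := u ^+ N; set C := u `^ _.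
have C01 : 1 <= C0 by rewrite exprn_ege1.
have C00 : 0 < C0 by rewrite exprn_gt0.
have CC0 : u ^+ 3 * C0 <= C.
  rewrite -exprD -powR_mulrn ?(ltW u0) //; apply: ler_powR => //.
  exact: constant_exponent_le.
have C0C : C0 <= C by apply: le_trans CC0; rewrite ler_peMl ?exprn_ege1 // ltW.
have mu0 := gibbs_gt0 E beta q0.
have contraction (f : {ffun V -> 'I_q} -> R) : (forall s, 0 < f s) ->
    C0^-1 * entropy (gibbs E beta) f <=
    \sum_s gibbs E beta s * (f s * ln (f s)) -
    \sum_s gibbs E beta s * (kernel_apply E beta f s * ln (kernel_apply E beta f s)).
  move=> f0; set drop := (X in _ <= X).
  have drop0 : 0 <= drop.
    apply: le_trans (isolated_entropy_le_drop q0 beta0 simpleE f0).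
    have := isolated_entropy_mono E q0 beta0 f0 (finset.sub0set [set: V]).
    by rewrite isolated_entropy0.
  have := entropy_drop q2 beta0 simpleE spectral marginal x0 f0 (drop_exponent_ge b eta).
  rewrite -/drop degE => h; rewrite mulrC ler_pdivrMr //.
  have p0 : 0 < (b / 2 ^+ Delta.+2) ^+ drop_exponent b eta.
    by rewrite exprn_gt0 // divr_gt0 // exprn_gt0.
  have pV : ((b / 2 ^+ Delta.+2) ^+ drop_exponent b eta)^-1 =
      (2 ^+ Delta.+2 / b) ^+ drop_exponent b eta.
    by rewrite -[LHS]exprVn invf_div.
  rewrite -(ler_pM2l p0); apply: le_trans h _.
  rewrite [leRHS]mulrA [leRHS]mulrAC ler_wpM2r // [leRHS]mulrC -ler_pdivrMr // pV.
  exact: drop_factor_le.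
have mu1 := gibbs_sum1 E beta q0.
have P0 := swendsen_wang_gt0 E q0 beta0.
have P1 := swendsen_wang_sum1 E beta q0.
have rev := @swendsen_wang_reversible R V E q beta simpleE.
split; last first.
  apply: le_trans (mls_constant_ge mu0 P0 P1 rev contraction).
  by rewrite lee_fin lef_pV2 ?posrE // (lt_le_trans C00).
have [k hk kN] := mixing_steps b0 b_half V2 C01.
have m0 : 0 < b ^+ (2 * #|V|) by rewrite exprn_gt0.
have m_le := gibbs_ge q2 marginal x0.
apply: (mixing_time_le mu0 mu1 P0 P1 rev contraction m0 m_le hk).
apply: le_trans kN _; rewrite ler_wpM2r // ln_ge0 // ler1n; exact: ltnW.
Qed.
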